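(* Fix $0\le\beta\le 1/2$ and consider the stochastic coupon probing problem $\mathbf{P.A}$ described in the context. Let $\mathrm{OPT}=\sup_\pi f(\pi)$, the supremum being over all probing policies $\pi$ feasible for $\mathbf{P.A}$. Then the policy $\textsc{stoch-CP}$ (with parameter $\beta$) satisfies \[ f(\textsc{stoch-CP}) \;\ge\; \frac{(1-1/e)(1-\beta)(1-2\beta)\beta}{2}\,\mathrm{OPT}. \]
   Context: Model. $\mathcal{V}$ is a finite set of users and $\mathcal{C}$ a finite set of coupons, each identified with its nonnegative value. For every $v\in\mathcal{V}$, $c\in\mathcal{C}$ there is an attractiveness $p_{v,c}\in[0,1]$, with $p_{v,c}\le p_{v,c'}$ whenever $c\le c'$. Each user $v$ independently draws a threshold $\sigma_v$ uniformly from $[0,1]$ and accepts coupon $c$ iff $p_{v,c}\ge\sigma_v$ (so $v$ accepts $c$ with probability $p_{v,c}$, and acceptances of different coupons by the same user are correlated through $\sigma_v$). $I:2^{\mathcal{V}}\to\mathbb{R}_{\ge0}$ is a monotone submodular function with $I(\emptyset)=0$ (the expected influence of a seed set). An action $(v,c)$ offers coupon $c$ to user $v$ and reveals whether $v$ accepts; if she accepts, $v$ becomes a seed and the value $c$ is paid (redeemed), otherwise nothing is paid. A probing policy adaptively chooses the next action as a function of the outcomes observed so far (possibly using internal randomness) and finally outputs the set $\mathcal{U}$ of users who accepted; its utility is $f(\pi)=\mathbb{E}[I(\mathcal{U})]$. Problem $\mathbf{P.A}$: maximize $f(\pi)$ over policies that, with probability one, probe each user at most $K$ times ($K$ a nonnegative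 integer constant; outer constraint) and redeem coupons of total value at most $B\ge 0$ (inner constraint). ALG I. Let $\mathcal{C}_l=\{c\in\mathcal{C}: c\le B/2\}$, sorted in nondecreasing order, and let $\Psi$ be the set of subsequences of $\mathcal{C}_l$ of length at most $K$. Let $\mathcal{S}=\mathcal{V}\times\Psi$; the action $(v,\psi)\in\mathcal{S}$ means offering the coupons of $\psi$ to $v$ one by one in order, stopping at the first acceptance (paying that coupon) or when $\psi$ is exhausted. Let $b_{v\psi}$ be the expected value paid when executing $(v,\psi)$. For $A\subseteq\mathcal{S}$ let $f(A)=\mathbb{E}[I(\{v:\exists (v,\psi)\in A \text{ such that } v \text{ accepts some coupon of } \psi\})]$. The continuous greedy procedure: set $\delta=1/(|\mathcal{V}||\Psi|)^2$, $\mathbf{y}(0)=\mathbf{0}$; for $t=0,\delta,2\delta,\dots$ while $t<1$: let $R(t)$ contain each $(v,\psi)$ independently with probability $y_{v\psi}(t)$, let $\omega_{v\psi}=\mathbb{E}[f(R(t)\cup\{(v,\psi)\})]-\mathbb{E}[f(R(t))]$, let $\mathbf{y}^*$ be an optimal solution of the linear program maximizing $\sum_{(v,\psi)\in\mathcal{S}}\omega_{v\psi}y_{v\psi}$ subject to $\sum_{\psi\in\Psi}y_{v\psi}\le1$ for all $v$, $\sum_{(v,\psi)\in\mathcal{S}}y_{v\psi}b_{v\psi}\le\beta B$, $0\le y_{v\psi}\le1$; set $\mathbf{y}(t+\delta)=\mathbf{y}(t)+\delta\mathbf{y}^*$. Let $\mathbf{y}^g$ be the final vector. Then: (1) let $R$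 contain each $(v,\psi)$ independently with probability $y^g_{v\psi}$; (2) apply a contention resolution scheme (in the sense of Vondrák–Chekuri–Zenklusen) for the partition matroid ''at most one action per user'' to $R$, obtaining $\mathcal{Z}\subseteq R$ with at most one action per user; (3) consider the actions of $\mathcal{Z}$ one by one in arbitrary order, executing the current action if the remaining budget is at least $B/2$ (deducting any redeemed coupon from the budget) and discarding it otherwise. ALG II. Let $c_{\max}=\max\mathcal{C}$. Sort users in nonincreasing order of $I(\{v\})$ and offer $c_{\max}$ to them one by one in this order, stopping as soon as a user accepts (or after the last user rejects). $\textsc{stoch-CP}$: run ALG I or ALG II, each chosen with probability $1/2$.
   Formalization: The contention resolution scheme in step (2) of ALG I, left unspecified, is taken to be any monotone (1−1/e)-balanced scheme at y^g; for an arbitrary scheme (e.g. one that always returns the empty set) the claimed bound fails. *)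

(* Defs.v *)
From mathcomp Require Import all_boot all_order all_algebra.
From mathcomp Require Import all_classical all_reals all_analysis.
From Stdlib Require List.
Set Implicit Arguments.
Unset Strict Implicit.
Unset Printing Implicit Defensive.
Import Order.TTheory GRing.Theory Num.Theory.
Local Open Scope ring_scope.

Section Coupons.
Variables (R : realType) (V C : finType).
(* cv c  = value of coupon c;  p v c = attractiveness p_{v,c};
   I     = influence function;  K, B  = outer / inner budgets. *)
Variables (cv : C -> R) (p : V -> C -> R) (I : {set V} -> R) (K : nat) (B : R).

(* A realization records, for every user v, her acceptance set
   {c | p v c >= sigma_v}.  Its probability is the product over users of the
   Lebesgue measure of the set of sigma_v in [0,1] producing that set. *)
Definition realization := {ffun V -> {set C}}.

Definition accept_weight (v : V) (S : {set C}) : R :=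
  fine (lebesgue_measure
          [set s : R | (0 <= s <= 1) /\ (forall c, c \in S <-> s <= p v c)]).

Definition rweight (w : realization) : R := \prod_(v : V) accept_weight v (w v).

Definition Expect (g : realization -> R) : R := \sum_(w : realization) rweight w * g w.

Definition hist := seq (V * C * bool).
Definition policy := hist -> option (V * C).

Fixpoint run (pi : policy) (w : realization) (n : nat) (h : hist) : hist :=
  match n with
  | 0 => h
  | n'.+1 => match pi h with
             | None => h
             | Some a => run pi w n' (rcons h (a, a.2 \in w a.1))
             end
  end.

(* K * |V| + 1 steps suffice to detect any violation of the outer constraint *)
Definition trace (pi : policy) (w : realization) : hist :=
  run pi w (K * #|V|).+1 [::].

Definition probes (v : V) (tr : hist) : nat := count (fun e => e.1.1 == v) tr.
Definition redeemed (tr : hist) : R := \sum_(e <- tr | e.2) cv e.1.2.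
Definition seeds (tr : hist) : {set V} :=
  [set v | has (fun e => (e.1.1 == v) && e.2) tr].

Definition det_feasible (pi : policy) : Prop :=
  forall w : realization, 0 < rweight w ->
    (forall v, (probes v (trace pi w) <= K)%N) /\ redeemed (trace pi w) <= B.

Definition det_value (pi : policy) : R := Expect (fun w => I (seeds (trace pi w))).

Definition rpolicy := seq (R * policy).

Definition rfeasible (rp : rpolicy) : Prop :=
  (forall x, List.In x rp -> 0 <= x.1) /\ \sum_(x <- rp) x.1 = 1 /\
  (forall x, List.In x rp -> 0 < x.1 -> det_feasible x.2).

Definition rvalue (rp : rpolicy) : R := \sum_(x <- rp) x.1 * det_value x.2.

Definition OPT : R := sup [set x | exists rp, rfeasible rp /\ x = rvalue rp].

Definition Cl : {set C} := [set c | cv c <= B / 2].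
(* subsequences of the sorted C_l of length <= K = subsets of C_l of size <= K,
   offered in nondecreasing order of value *)
Definition Psi : {set {set C}} := [set psi : {set C} | (psi \subset Cl) && (#|psi| <= K)%N].
Definition act := (V * {set C})%type.
Definition Sact : {set act} := [set s : act | s.2 \in Psi].

Definition offer_order (psi : {set C}) : seq C := sort (fun a b => cv a <= cv b) (enum psi).
Definition first_acc (psi : {set C}) (A : {set C}) : option C :=
  ohead [seq c <- offer_order psi | c \in A].
Definition paid (psi : {set C}) (A : {set C}) : R :=
  if first_acc psi A is Some c then cv c else 0.

Definition bcost (s : act) : R := Expect (fun w => paid s.2 (w s.1)).

Definition fS (A : {set act}) : R :=
  Expect (fun w => I [set v | [exists s in A, (s.1 == v) && (first_acc s.2 (w v) != None)]]).

Definition probR (y : act -> R) (A : {set act}) : R :=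
  \prod_(s in Sact) (if s \in A then y s else 1 - y s).
Definition ER (y : act -> R) (g : {set act} -> R) : R :=
  \sum_(A : {set act} | A \subset Sact) probR y A * g A.

Definition marg (y : act -> R) (s : act) : R := ER y (fun A => fS (s |: A)) - ER y fS.

Definition LPfeas (beta : R) (z : act -> R) : Prop :=
  (forall s, s \notin Sact -> z s = 0) /\
  (forall s, 0 <= z s <= 1) /\
  (forall v, \sum_(psi in Psi) z (v, psi) <= 1) /\
  \sum_(s in Sact) z s * bcost s <= beta * B.

Definition LPopt (beta : R) (y z : act -> R) : Prop :=
  LPfeas beta z /\
  forall z', LPfeas beta z' ->
    \sum_(s in Sact) marg y s * z' s <= \sum_(s in Sact) marg y s * z s.

Definition Nsteps : nat := ((#|V| * #|Psi|) ^ 2)%N.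
Definition delta : R := 1 / (Nsteps%:R).

(* ys is a run of the continuous greedy: y(k delta) = ys k, for k = 0..Nsteps;
   the final vector y^g is ys Nsteps *)
Definition cg_run (beta : R) (ys : nat -> act -> R) : Prop :=
  (forall s, ys 0%N s = 0) /\
  forall k, (k < Nsteps)%N ->
    exists ystar, LPopt beta (ys k) ystar /\
                  forall s, ys k.+1 s = ys k s + delta * ystar s.

(* randomized contention resolution scheme for the partition matroid
   "at most one action per user", at the point x: crs A Z = Pr[pi_x(A) = Z] *)
Definition is_crs (x : act -> R) (crs : {set act} -> {set act} -> R) : Prop :=
  forall A : {set act},
    (forall Z, 0 <= crs A Z) /\ \sum_(Z : {set act}) crs A Z = 1 /\
    (forall Z, 0 < crs A Z ->
       Z \subset A :&: [set s | 0 < x s] /\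
       forall v, (#|[set s in Z | s.1 == v]| <= 1)%N).

Definition psel (crs : {set act} -> {set act} -> R) (A : {set act}) (s : act) : R :=
  \sum_(Z : {set act} | s \in Z) crs A Z.

(* c-balanced: Pr[s in pi_x(R(x)) | s in R(x)] >= c *)
Definition crs_balanced (c : R) (x : act -> R) crs : Prop :=
  forall s, s \in Sact -> 0 < x s ->
    c * x s <= ER x (fun A => if s \in A then psel crs A s else 0).

Definition crs_monotone (crs : {set act} -> {set act} -> R) : Prop :=
  forall (s : act) (A A' : {set act}), s \in A -> A \subset A' -> psel crs A' s <= psel crs A s.

Fixpoint exec (w : realization) (rem : R) (l : seq act) (U : {set V}) : {set V} :=
  match l with
  | [::] => U
  | s :: l' =>
      if B / 2 <= rem then
        exec w (rem - paid s.2 (w s.1)) l'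
             (if first_acc s.2 (w s.1) is Some _ then s.1 |: U else U)
      else exec w rem l' U
  end.

Definition algI_value (yg : act -> R) (crs : {set act} -> {set act} -> R) (ord : {set act} -> seq act) : R :=
  ER yg (fun A => \sum_(Z : {set act}) crs A Z *
                  Expect (fun w => I (exec w B (ord Z) finset.set0))).

Definition algII_value (cmax : C) (lst : seq V) : R :=
  Expect (fun w => I (if ohead [seq v <- lst | cmax \in w v] is Some v then [set v] else finset.set0)).

Definition stochCP_value (ys : nat -> act -> R) (crs : {set act} -> {set act} -> R) (ord : {set act} -> seq act) (cmax : C) (lst : seq V) : R :=
  (algI_value (ys Nsteps) crs ord + algII_value cmax lst) / 2.

End Coupons.

(* Main.v *)
Require Import Defs.
From mathcomp Require Import all_boot all_order all_algebra.
From mathcomp Require Import all_classical all_reals all_analysis.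
From mathcomp Require Import ring lra zify.
Import Order.TTheory GRing.Theory Num.Theory.
Local Open Scope ring_scope.
Set Implicit Arguments.
Unset Strict Implicit.
Unset Printing Implicit Defensive.

(* Split the seeds of an adaptive policy into those obtained within C_l and the
   rest. At most one user can redeem a coupon above B/2, so the rest is worth at
   most J, the value of ALG II.

   The coupons of C_l that a user is offered as long as she rejects are independent
   of her threshold; their law x satisfies the linear program with budget B, so
   beta x is feasible for the program of the greedy. Let O be the value of this
   part of the policy and F the multilinear extension. Comparing with a fresh copy
   of the realization gives O - 2 F(y) <= sum_s x_s omega_s(y). One unit of F is
   lost because omega does not count users who are already seeds in R(t), and the
   greedy compares omega rather than the derivative of F. Hence a step of the
   greedy gains at least q (O - 2 F) with q = delta beta (1 - eps) and
   eps = delta |V|, so that F(y^g) >= (a - a^2) O for a = beta (1 - eps). This is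
   beta (1 - beta) O up to beta eps O, which ALG II recovers: O <= |V| J and
   eps |V| <= 1.

   For the rounding, order the users and charge each seed v its gain over the
   seeds of R before v. Action s = (v, psi) is certainly executed when the other
   users' actions in R pay at most B/2, which by Markov has probability at least
   1 - 2 beta. Given the acceptance of s, the selection of s by the resolution
   scheme, this event, and the gain of v are all decreasing in suitable orders, so
   Harris' inequality bounds the expectation of their product from below. *)

(** * Product expectations and Harris' inequality *)

Section ProductExpectation.
Variables (R : realFieldType) (T X : finType).
Implicit Types (mu : T -> X -> R) (w : {ffun T -> X}) (f g : {ffun T -> X} -> R).

Definition upd w t x : {ffun T -> X} := [ffun u => if u == t then x else w u].

Lemma upd_same w t x : upd w t x t = x.
Proof. by rewrite ffunE eqxx. Qed.

Lemma upd_neq w t x u : u != t -> upd w t x u = w u.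
Proof. by move=> /negPf H; rewrite ffunE H. Qed.

Lemma upd_id w t : upd w t (w t) = w.
Proof. by apply/ffunP => u; rewrite ffunE; case: eqP => [->|]. Qed.

Lemma upd_upd w t x y : upd (upd w t x) t y = upd w t y.
Proof. by apply/ffunP => u; rewrite !ffunE; case: eqP. Qed.

Lemma upd_comm w t u x y : t != u -> upd (upd w t x) u y = upd (upd w u y) t x.
Proof.
move=> ntu; apply/ffunP => z; rewrite !ffunE.
by case: (z =P u) => // ->; rewrite eq_sym (negPf ntu).
Qed.

Definition indep t g := forall w x, g (upd w t x) = g w.

Definition PE mu g := \sum_(w : {ffun T -> X}) (\prod_t mu t (w t)) * g w.

(** The conditional expectation of [g] given the coordinates other than [t], kept as a function of
    the whole [w] so that it can be iterated. *)
Definition avg mu t g w := \sum_x mu t x * g (upd w t x).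

Definition stochastic mu := (forall t x, 0 <= mu t x) /\ (forall t, \sum_x mu t x = 1).

Lemma PE_const mu k : stochastic mu -> PE mu (fun=> k) = k.
Proof.
move=> [_ m1]; rewrite /PE -mulr_suml -(bigA_distr_bigA (fun t x => mu t x)).
by rewrite big1 ?mul1r // => t _; exact: m1.
Qed.

Lemma PE_weight_ge0 mu w : stochastic mu -> 0 <= \prod_t mu t (w t).
Proof. by case=> m0 _; apply: prodr_ge0 => t _. Qed.

Lemma eq_PE mu f g : f =1 g -> PE mu f = PE mu g.
Proof. by move=> fg; apply: eq_bigr => w _; rewrite fg. Qed.

Lemma PE_le mu f g : stochastic mu ->
  (forall w, 0 < \prod_t mu t (w t) -> f w <= g w) -> PE mu f <= PE mu g.
Proof.
move=> sm fg; apply: ler_sum => w _.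
have := PE_weight_ge0 w sm; rewrite le_eqVlt => /orP[/eqP <-|w0].
  by rewrite !mul0r.
by apply: ler_wpM2l; [exact: ltW | exact: fg].
Qed.

Lemma PE_ge0 mu g : stochastic mu -> (forall w, 0 <= g w) -> 0 <= PE mu g.
Proof. by move=> sm g0; rewrite -(PE_const 0 sm); apply: PE_le. Qed.

Lemma PED mu f g : PE mu (fun w => f w + g w) = PE mu f + PE mu g.
Proof. by rewrite /PE -big_split; apply: eq_bigr => w _; rewrite mulrDr. Qed.

Lemma PEZ mu k g : PE mu (fun w => k * g w) = k * PE mu g.
Proof. by rewrite /PE mulr_sumr; apply: eq_bigr => w _; rewrite mulrCA. Qed.

Lemma PEZr mu k g : PE mu (fun w => g w * k) = PE mu g * k.
Proof. by rewrite mulrC -PEZ; apply: eq_PE => w; rewrite mulrC. Qed.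

Lemma PEB mu f g : PE mu (fun w => f w - g w) = PE mu f - PE mu g.
Proof.
rewrite -[- PE mu g]mulN1r -PEZ -PED; apply: eq_PE => w; by rewrite mulN1r.
Qed.

Lemma PE_sum mu (J : Type) (r : seq J) (P : pred J) (F : J -> {ffun T -> X} -> R) :
  PE mu (fun w => \sum_(j <- r | P j) F j w) = \sum_(j <- r | P j) PE mu (F j).
Proof.
rewrite /PE exchange_big; apply: eq_bigr => w _; by rewrite mulr_sumr.
Qed.

(* The pairs (w, x) and (w[t := x], w t) are exchanged by a weight-preserving
   involution. *)
Lemma PE_avg mu t g : stochastic mu -> PE mu (avg mu t g) = PE mu g.
Proof.
move=> [m0 m1]; rewrite /PE /avg.
transitivity (\sum_(w : {ffun T -> X}) \sum_x (\prod_u mu u (w u)) * mu t x * g w); last first.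
  by apply: eq_bigr => w _; rewrite -mulr_suml -mulr_sumr m1 mulr1.
under eq_bigr => w _ do rewrite mulr_sumr.
rewrite !pair_bigA /=.
pose h (a : {ffun T -> X} * X) := (upd a.1 t a.2, a.1 t).
have hK : involutive h.
  by move=> [w x]; rewrite /h /= upd_upd upd_same upd_id.
rewrite [RHS](reindex h) /=; last by exists h => a _; exact: hK.
apply: eq_bigr => -[w x] _ /=; rewrite mulrA; congr (_ * _).
rewrite (bigD1 t) //= [in RHS](bigD1 t) //= upd_same.
rewrite [in RHS](eq_bigr (fun u => mu u (w u))); first by ring.
by move=> u ut; rewrite upd_neq.
Qed.

Lemma PE_indep mu t (a : X -> R) g : stochastic mu -> indep t g ->
  PE mu (fun w => a (w t) * g w) = (\sum_x mu t x * a x) * PE mu g.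
Proof.
move=> sm ig; rewrite -(PE_avg t (fun w => a (w t) * g w) sm) -PEZ.
apply: eq_PE => w; rewrite /avg mulr_suml; apply: eq_bigr => x _.
by rewrite upd_same ig mulrA.
Qed.

Lemma PE_coord mu t (a : X -> R) : stochastic mu ->
  PE mu (fun w => a (w t)) = \sum_x mu t x * a x.
Proof.
move=> sm; have := @PE_indep mu t a (fun=> 1) sm (fun _ _ => erefl).
by rewrite PE_const // mulr1 => <-; apply: eq_PE => w; rewrite mulr1.
Qed.

Lemma PE_indepM mu t (a : X -> R) g : stochastic mu -> indep t g ->
  PE mu (fun w => a (w t) * g w) = PE mu (fun w => a (w t)) * PE mu g.
Proof. by move=> sm ig; rewrite PE_indep // PE_coord. Qed.

Definition avgs mu (l : seq T) g := foldr (avg mu) g l.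

Lemma PE_avgs mu l g : stochastic mu -> PE mu (avgs mu l g) = PE mu g.
Proof. by move=> sm; elim: l => //= t l IH; rewrite PE_avg. Qed.

Lemma indep_avgs mu l t g : (t \in l) \/ indep t g -> indep t (avgs mu l g).
Proof.
elim: l => [[]//|u l IH /= H] w x; rewrite /avg; apply: eq_bigr => y _.
congr (_ * _); have [tu|ntu] := eqVneq t u; first by rewrite -tu upd_upd.
rewrite upd_comm //; apply: IH; case: H; last by right.
by rewrite inE (negPf ntu); left.
Qed.

Lemma indep_all g w w' : (forall t, indep t g) -> g w = g w'.
Proof.
move=> ig; pose h l := foldr (fun t w0 => upd w0 t (w' t)) w l.
have gh l : g (h l) = g w by elim: l => //= t l <-; exact: ig.
rewrite -(gh (enum T)); congr g; apply/ffunP => t.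
have : t \in enum T by rewrite mem_enum.
elim: (enum T) => //= u l IH; rewrite inE ffunE.
by case: (t =P u) => [->//|_] /= /IH.
Qed.

(** When each coordinate is averaged out or ignored by [g], the iterated average is constant, so it
    equals its own expectation, which averaging preserves. *)
Lemma avgs_PE mu l g w : stochastic mu ->
  (forall t, (t \in l) \/ indep t g) -> avgs mu l g w = PE mu g.
Proof.
move=> sm H; rewrite -(PE_avgs l g sm) -[LHS](PE_const _ sm).
by apply: eq_PE => w'; apply: indep_all => t; exact: indep_avgs.
Qed.

Lemma PE_eq_mu mu mu' t g : stochastic mu -> stochastic mu' ->
  (forall u, u != t -> mu u =1 mu' u) -> indep t g -> PE mu g = PE mu' g.
Proof.
move=> sm sm' mm ig.
(* The iterated averages are evaluated at a base point; if there is none, both sums are empty. *)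
have [w _|T0] := pickP (predT : pred {ffun T -> X}); last first.
  by rewrite /PE !big1 // => w; have := T0 w.
pose l := [seq u <- enum T | u != t].
have H u : (u \in l) \/ indep u g.
  have [->|ut] := eqVneq u t; first by right.
  by left; rewrite mem_filter ut mem_enum.
rewrite -(avgs_PE w sm H) -(avgs_PE w sm' H).
have : {subset l <= predC1 t} by move=> u; rewrite mem_filter => /andP[].
elim: l w {H} => //= u l IH w lt; rewrite /avg; apply: eq_bigr => x _.
rewrite mm ?IH //; first by move=> v vl; apply: lt; rewrite inE vl orbT.
by apply: (lt u); rewrite inE eqxx.
Qed.

(** Each coordinate carries its own relation, so that it can be ordered in a way suited to the
    functions compared by [harris]. *)
Definition decr (r : T -> rel X) g :=
  forall w t x y, r t x y -> g (upd w t y) <= g (upd w t x).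

Lemma avg_le mu t f g w : stochastic mu -> (forall w, f w <= g w) ->
  avg mu t f w <= avg mu t g w.
Proof. by move=> [m0 _] fg; apply: ler_sum => x _; apply: ler_wpM2l. Qed.

Lemma decr_avg mu r t g : stochastic mu -> decr r g -> decr r (avg mu t g).
Proof.
move=> [m0 _] dg w u x y rxy; apply: ler_sum => z _; apply: ler_wpM2l => //.
have [->|nut] := eqVneq u t; first by rewrite !upd_upd.
by rewrite !(upd_comm _ _ _ nut); exact: dg.
Qed.

Lemma decr_avgs mu r l g : stochastic mu -> decr r g -> decr r (avgs mu l g).
Proof. by move=> sm dg; elim: l => //= t l; exact: decr_avg. Qed.

(** The differences of [a] and of [b] between two points have the same sign; the double sum of their
    products is twice the covariance. *)
Lemma chebyshev_sum (m : X -> R) (r : rel X) (a b : X -> R) :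
  (forall x, 0 <= m x) -> \sum_x m x = 1 -> total r ->
  (forall x y, r x y -> a y <= a x) -> (forall x y, r x y -> b y <= b x) ->
  (\sum_x m x * a x) * (\sum_x m x * b x) <= \sum_x m x * (a x * b x).
Proof.
move=> m0 m1 tr da db.
have S0 : 0 <= \sum_x \sum_y m x * m y * ((a x - a y) * (b x - b y)).
  apply: sumr_ge0 => x _; apply: sumr_ge0 => y _.
  apply: mulr_ge0; first exact: mulr_ge0.
  have /orP[rxy|rxy] := tr x y.
    by apply: mulr_ge0; rewrite subr_ge0; [exact: da | exact: db].
  by apply: mulr_le0; rewrite subr_le0; [exact: da | exact: db].
have E : \sum_x \sum_y m x * m y * ((a x - a y) * (b x - b y)) =
   2 * (\sum_x m x * (a x * b x)) - 2 * ((\sum_x m x * a x) * (\sum_x m x * b x)).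
  transitivity (\sum_x (m x * (a x * b x) * 1 + m x * (\sum_y m y * (a y * b y))
     - m x * a x * (\sum_y m y * b y) - m x * b x * (\sum_y m y * a y))).
    apply: eq_bigr => x _; rewrite -[in RHS]m1 !mulr_sumr -!big_split -!sumrB /=.
    by apply: eq_bigr => y _; ring.
  rewrite !sumrB big_split /= -!mulr_suml m1; ring.
by move: S0; rewrite E; lra.
Qed.

Lemma avg_chebyshev mu r t f g w : stochastic mu -> total (r t) ->
  decr r f -> decr r g ->
  avg mu t f w * avg mu t g w <= avg mu t (fun w => f w * g w) w.
Proof.
move=> [m0 m1] tr df dg.
apply: (@chebyshev_sum _ (r t)) => // x y; [exact: df | exact: dg].
Qed.

(** Chebyshev's inequality is applied to one coordinate at a time; averaging preserves [decr], so
    the induction goes through. *)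
Lemma harris mu r f g : stochastic mu -> (forall t, total (r t)) ->
  decr r f -> decr r g -> PE mu f * PE mu g <= PE mu (fun w => f w * g w).
Proof.
move=> sm tr df dg.
have [w _|T0] := pickP (predT : pred {ffun T -> X}); last first.
  by rewrite /PE !big1 ?mul0r // => w; have := T0 w.
have H h t : (t \in enum T) \/ indep t h by left; rewrite mem_enum.
rewrite -!(avgs_PE w sm (H _)).
elim: (enum T) w => //= t l IH w.
apply: le_trans (avg_le _ _ sm IH).
by apply: avg_chebyshev (tr t) _ _ => //; exact: decr_avgs.
Qed.

End ProductExpectation.

(** * Bernoulli random sets *)

Section BernoulliSets.
Variables (R : realFieldType) (T : finType).
Implicit Types (y d : T -> R) (g h : {set T} -> R) (A : {set T}).

Definition bern y (s : T) (b : bool) : R := if b then y s else 1 - y s.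

Definition EB y g := PE (bern y) (fun f => g [set s | f s]).

Definition unit_valued y := forall s, 0 <= y s <= 1.

Definition set_incr g := forall A A', A \subset A' -> g A <= g A'.

Definition set_decr g := forall A A', A \subset A' -> g A' <= g A.

Lemma bern_stochastic y : unit_valued y -> stochastic (bern y).
Proof.
move=> y01; split=> [s [|]|s] /=; try by have := y01 s; lra.
by rewrite big_bool /=; ring.
Qed.

Lemma EB_sumE y g :
  EB y g = \sum_(A : {set T}) (\prod_s (if s \in A then y s else 1 - y s)) * g A.
Proof.
rewrite /EB /PE (reindex (fun A : {set T} => [ffun s => s \in A])) /=; last first.
  exists (fun f : {ffun T -> bool} => [set s | f s]) => [A _|f _].
    by apply/finset.setP => s; rewrite inE ffunE.
  by apply/ffunP => s; rewrite ffunE inE.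
apply: eq_bigr => A _; congr (_ * g _).
  by apply: eq_bigr => s _; rewrite ffunE.
by apply/finset.setP => s; rewrite inE ffunE.
Qed.

Lemma set_upd_true (f : {ffun T -> bool}) s :
  [set u | upd f s true u] = s |: [set u | f u].
Proof. by apply/finset.setP => u; rewrite !inE ffunE; case: eqP. Qed.

Lemma set_upd_false (f : {ffun T -> bool}) s :
  [set u | upd f s false u] = [set u | f u] :\ s.
Proof. by apply/finset.setP => u; rewrite !inE ffunE; case: eqP. Qed.

Lemma EB_split y g s : unit_valued y ->
  EB y g = y s * EB y (fun A => g (s |: A)) + (1 - y s) * EB y (fun A => g (A :\ s)).
Proof.
move=> y01; rewrite /EB -(PE_avg s _ (bern_stochastic y01)) -!PEZ -PED.
by apply: eq_PE => f; rewrite /avg big_bool /= set_upd_true set_upd_false.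
Qed.

Lemma EB_eq_off y y' g s : unit_valued y -> unit_valued y' ->
  (forall u, u != s -> y u = y' u) ->
  (forall A, g (s |: A) = g A) -> EB y g = EB y' g.
Proof.
move=> y01 y01' yy' gs; apply: (@PE_eq_mu _ _ _ _ _ s).
- exact: bern_stochastic.
- exact: bern_stochastic.
- by move=> u us b; rewrite /bern yy'.
move=> f b; case: b; rewrite ?set_upd_true ?set_upd_false ?gs //.
by rewrite -[LHS]gs -[RHS]gs; congr g; apply/finset.setP => u; rewrite !inE; case: eqP.
Qed.

Lemma EB_const y k : unit_valued y -> EB y (fun=> k) = k.
Proof. by move=> y01; exact/PE_const/bern_stochastic. Qed.

Lemma eq_EB y g h : g =1 h -> EB y g = EB y h.
Proof. by move=> gh; apply: eq_PE => f; rewrite gh. Qed.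

Lemma EB_le y g h : unit_valued y -> (forall A, g A <= h A) -> EB y g <= EB y h.
Proof. by move=> y01 gh; apply: PE_le => [|f _]; [exact: bern_stochastic|]. Qed.

Lemma EB_ge0 y g : unit_valued y -> (forall A, 0 <= g A) -> 0 <= EB y g.
Proof. by move=> y01 g0; apply: PE_ge0 => //; exact: bern_stochastic. Qed.

Lemma EBD y g h : EB y (fun A => g A + h A) = EB y g + EB y h.
Proof. exact: PED. Qed.

Lemma EBB y g h : EB y (fun A => g A - h A) = EB y g - EB y h.
Proof. exact: PEB. Qed.

Lemma EBZ y k g : EB y (fun A => k * g A) = k * EB y g.
Proof. exact: PEZ. Qed.

Lemma EB_sum y (J : Type) (r : seq J) (P : pred J) (F : J -> {set T} -> R) :
  EB y (fun A => \sum_(j <- r | P j) F j A) = \sum_(j <- r | P j) EB y (F j).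
Proof. exact: PE_sum. Qed.

Lemma EB_in y g s : unit_valued y ->
  EB y (fun A => if s \in A then g A else 0) = y s * EB y (fun A => g (s |: A)).
Proof.
move=> y01; rewrite (EB_split _ s y01) [X in _ + _ * X](_ : _ = 0).
  rewrite mulr0 addr0; congr (_ * _); apply: eq_EB => A.
  by rewrite in_setU1 eqxx.
rewrite -[RHS](EB_const 0 y01); apply: eq_EB => A.
by rewrite in_setD1 eqxx.
Qed.

Lemma EB_harris y g h : unit_valued y -> set_decr g -> set_decr h ->
  EB y g * EB y h <= EB y (fun A => g A * h A).
Proof.
move=> y01 dg dh.
have D k : set_decr k -> decr (fun=> implb : rel bool)
    (fun f : {ffun T -> bool} => k [set s | f s]).
  move=> dk f s [] [] //= _; rewrite ?set_upd_true ?set_upd_false //; apply: dk.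
  by apply/fintype.subsetP => u; rewrite !inE => /andP[_ ->]; rewrite orbT.
apply: (@harris _ _ _ _ (fun=> implb : rel bool)).
- exact: bern_stochastic.
- by move=> _ [] [].
- exact: D.
- exact: D.
Qed.

(** Bits are averaged one at a time: raising the probability of a bit moves weight to the larger of
    two values. Increasing functions are [decr] for the reversed implication. *)
Lemma EB_incr y y' g : unit_valued y -> unit_valued y' ->
  (forall s, y s <= y' s) -> set_incr g -> EB y g <= EB y' g.
Proof.
move=> y01 y01' yy' ig.
have sm := bern_stochastic y01; have sm' := bern_stochastic y01'.
pose G (f : {ffun T -> bool}) := g [set s | f s].
have dG : decr (fun=> fun a b : bool => b ==> a) G.
  move=> f s [] [] //= _; rewrite /G ?set_upd_true ?set_upd_false //; apply: ig.
  by apply/fintype.subsetP => u; rewrite !inE => /andP[_ ->]; rewrite orbT.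
rewrite /EB -/(G) -(PE_avgs (enum T) G sm) -(PE_avgs (enum T) G sm').
have H l f : avgs (bern y) l G f <= avgs (bern y') l G f.
  elim: l f => //= s l IH f.
  apply: le_trans (avg_le _ _ sm' IH).
  rewrite /avg !big_bool /=.
  have D := decr_avgs l sm dG; have := D f s true false isT.
  by have := yy' s; nra.
(* All bits being averaged out, the function is constant and the outer law may be replaced. *)
have -> : PE (bern y) (avgs (bern y) (enum T) G) = PE (bern y') (avgs (bern y) (enum T) G).
  have := avgs_PE _ sm (fun t => or_introl (mem_enum T t) : (t \in enum T) \/ indep t G).
  by move=> E; rewrite (eq_PE _ (fun f => E f)) (eq_PE (bern y') (fun f => E f)) !PE_const.
by apply: PE_le => // f _; exact: H.
Qed.

Lemma EB_le_support y g h : unit_valued y ->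
  (forall A, (forall s, s \in A -> 0 < y s) -> g A <= h A) -> EB y g <= EB y h.
Proof.
move=> y01 gh; rewrite !EB_sumE; apply: ler_sum => A _.
have [/forallP H|/forallPn[s]] := boolP [forall s, (s \in A) ==> (0 < y s)].
  apply: ler_wpM2l; last by apply: gh => s; exact/implyP.
  by apply: prodr_ge0 => s _; case: ifP => _; have := y01 s; lra.
rewrite negb_imply => /andP[sA ys].
have y0 : y s = 0.
  by apply/eqP; have /andP[y0 _] := y01 s; rewrite eq_le y0 andbT leNgt.
by rewrite (bigD1 s) //= sA y0 !mul0r.
Qed.

Lemma EB_card_sum y (b : T -> R) : unit_valued y ->
  EB y (fun A => \sum_(s in A) b s) = \sum_s y s * b s.
Proof.
move=> y01; rewrite (eq_EB _ (fun A => big_mkcond _ _)) EB_sum.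
by apply: eq_bigr => s _; rewrite (EB_in (fun=> b s)) // EB_const.
Qed.

Lemma prod_1B_ge (J : Type) (r : seq J) (d : J -> R) : (forall j, 0 <= d j <= 1) ->
  1 - \sum_(j <- r) d j <= \prod_(j <- r) (1 - d j).
Proof.
move=> d01; elim: r => [|j r IH]; first by rewrite !big_nil subr0.
rewrite !big_cons.
have S0 : 0 <= \sum_(j <- r) d j by apply: sumr_ge0 => i _; case/andP: (d01 i).
have := d01 j; nra.
Qed.

(* Adding an independent D with marginals d to the random set of marginals y
   dominates what is gained when D is a singleton.  The coordinates are switched
   one at a time from y to y + d(1 - y), the marginals of the union. *)
Lemma EB_step y d g : unit_valued y -> unit_valued d ->
  unit_valued (fun s => y s + d s) -> set_incr g ->
  EB y g + (1 - \sum_s d s) * (\sum_s d s * (EB y (fun A => g (s |: A)) - EB y g))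
    <= EB (fun s => y s + d s) g.
Proof.
move=> y01 d01 yd01 ig.
pose yl (l : seq T) s := if s \in l then y s + d s * (1 - y s) else y s.
have yl01 l : unit_valued (yl l).
  by move=> s; rewrite /yl; case: ifP => _; have := y01 s; have := d01 s; nra.
have phi0 s : 0 <= EB y (fun A => g (s |: A)) - EB y g.
  rewrite subr_ge0; apply: EB_le => // A; apply: ig; exact: finset.subsetUr.
(* Replacing [y] by [yl l] leaves each bit at least the fraction [1 - d u] of either probability, so
   every set keeps at least the fraction [\prod_s (1 - d s)] of its weight. *)
have dom l s : (1 - \sum_s d s) * (EB y (fun A => g (s |: A)) - EB y g) <=
    EB (yl l) (fun A => g (s |: A)) - EB (yl l) g.
  apply: (@le_trans _ _ ((\prod_s (1 - d s)) * (EB y (fun A => g (s |: A)) - EB y g))).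
    by apply: ler_wpM2r => //; exact: prod_1B_ge.
  rewrite -!EBB !EB_sumE mulr_sumr; apply: ler_sum => A _; rewrite mulrA.
  apply: ler_wpM2r; first by rewrite subr_ge0; apply: ig; exact: finset.subsetUr.
  rewrite -big_split /=; apply: ler_prod => u _; rewrite /yl.
  by do 2 case: ifP => _; have := y01 u; have := d01 u; nra.
(* Switching [s] raises the expectation by [d s] times the difference bounded below in [dom], since
   [1 - y s] times the effect of the bit is the gain of adding [s]. *)
have main l : uniq l -> EB y g + (1 - \sum_s d s) *
    (\sum_(s <- l) d s * (EB y (fun A => g (s |: A)) - EB y g)) <= EB (yl l) g.
  elim: l => [_|s l IH /= /andP[sl ul]].
    by rewrite big_nil mulr0 addr0.
  have := IH ul; rewrite big_cons.
  have off (k : {set T} -> R) : (forall A, k (s |: A) = k A) -> EB (yl (s :: l)) k = EB (yl l) k.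
    by apply: EB_eq_off => // u us; rewrite /yl inE (negPf us).
  have g1 A : g (s |: (s |: A)) = g (s |: A) by rewrite finset.setUA finset.setUid.
  have g0 A : g ((s |: A) :\ s) = g (A :\ s).
    by congr g; apply/finset.setP => u; rewrite !inE; case: eqP.
  have E1 := EB_split g s (yl01 (s :: l)); have E0 := EB_split g s (yl01 l).
  rewrite (off (fun A => g (s |: A)) g1) (off (fun A => g (A :\ s)) g0) in E1.
  have := dom l s; rewrite E1 E0 /yl inE eqxx (negPf sl) /=.
  move: (EB _ (fun A => g (s |: A))) (EB _ (fun A => g (A :\ s))) => e1 e0.
  set S := \sum_(j <- l) _; set D := \sum_s d s; set P := _ - EB y g.
  have /andP[d0 _] := d01 s.
  move=> dm ih; have := ler_wpM2l d0 dm; lra.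
(* With all coordinates switched the marginals are [y s + d s * (1 - y s)], at most [y s + d s], and
   [g] is increasing. *)
have := main (enum T) (enum_uniq T); rewrite [\sum_(s <- enum T) _]big_enum /=.
move=> H; apply: le_trans H _.
apply: EB_incr => // s; rewrite /yl mem_enum inE.
by have := y01 s; have := d01 s; nra.
Qed.

End BernoulliSets.

(** * Submodular functions *)

Section Submodular.
Variables (R : realFieldType) (V : finType) (I : {set V} -> R).
Hypothesis I0 : I finset.set0 = 0.
Hypothesis Imono : forall A A' : {set V}, A \subset A' -> I A <= I A'.
Hypothesis Isub : forall A A' : {set V}, I (A :|: A') + I (A :&: A') <= I A + I A'.
Implicit Types (X Y U : {set V}) (v : V).

Definition gain v X := I (v |: X) - I X.

Lemma gain_ge0 v X : 0 <= gain v X.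
Proof. by rewrite subr_ge0; apply: Imono; exact: finset.subsetUr. Qed.

(** If [v] is outside [Y], this is submodularity for [v |: X] and [Y], which meet in [X]; otherwise
    the gain over [Y] vanishes. *)
Lemma gain_decr v X Y : X \subset Y -> gain v Y <= gain v X.
Proof.
move=> XY; have [vY|vY] := boolP (v \in Y).
  rewrite {1}/gain (finset.setUidPr _) ?finset.sub1set // subrr; exact: gain_ge0.
rewrite /gain.
have := Isub (v |: X) Y.
have -> : (v |: X) :|: Y = v |: Y by rewrite -finset.setUA (finset.setUidPr XY).
have -> : (v |: X) :&: Y = X.
  apply/finset.setP => u; rewrite !inE; case: (u =P v) => [->|_] /=.
    by rewrite (negPf vY); apply/esym/negP => /(fintype.subsetP XY); rewrite (negPf vY).
  by case: (boolP (u \in X)) => // /(fintype.subsetP XY) ->.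
lra.
Qed.

Lemma union_le X Y : I (X :|: Y) <= I X + \sum_(v in Y) gain v X.
Proof.
have E : X :|: Y = X :|: [set v in enum Y].
  by congr (_ :|: _); apply/finset.setP => v; rewrite inE mem_enum.
rewrite E -big_enum /=; elim: (enum Y) => [|v l IH].
  rewrite big_nil addr0 (_ : _ :|: _ = X) //.
  by apply/finset.setP => u; rewrite !inE orbF.
rewrite big_cons.
have -> : X :|: [set u in v :: l] = v |: (X :|: [set u in l]).
  by apply/finset.setP => u; rewrite !inE orbCA.
have := @gain_decr v X (X :|: [set u in l]) (finset.subsetUl _ _).
by rewrite {1}/gain; lra.
Qed.

Definition before U v := [set u in U | (enum_rank u < enum_rank v)%N].

Lemma in_before u U v :
  (u \in before U v) = (u \in U) && (enum_rank u < enum_rank v)%N.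
Proof. by rewrite inE. Qed.

(** Telescoping as the members of [U] are added by increasing [enum_rank]. *)
Lemma chain_eq U : I U = \sum_(v in U) gain v (before U v).
Proof.
pose B (k : nat) := [set u in U | (enum_rank u < k)%N].
have E k : (k <= #|V|)%N ->
    I (B k) = \sum_(v in U | (enum_rank v < k)%N) gain v (before U v).
  elim: k => [_|k IH kV].
    rewrite big_pred0 => [|v]; last by rewrite andbF.
    by rewrite (_ : B 0%N = finset.set0) //; apply/finset.setP => u; rewrite !inE andbF.
  pose v := enum_val (Ordinal kV : 'I_(#|V|)).
  have rv u : (enum_rank u < k.+1)%N = (u == v) || (enum_rank u < k)%N.
    rewrite ltnS leq_eqVlt; congr (_ || _); apply/eqP/eqP => [H|->].
      by apply: enum_rank_inj; apply: val_inj; rewrite /= H /v enum_valK.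
    by rewrite /v enum_valK.
  have rvk : enum_rank v = k :> nat by rewrite /v enum_valK.
  have [vU|vU] := boolP (v \in U).
    rewrite (bigD1 v) /=; last by rewrite vU rv eqxx.
    rewrite (eq_bigl (fun u => (u \in U) && (enum_rank u < k)%N)); last first.
      move=> u; rewrite rv; case: (u =P v) => [->|_] /=; last by rewrite andbT.
      by rewrite rvk ltnn !andbF.
    rewrite -IH; last exact: ltnW.
    rewrite (_ : before U v = B k); last first.
      by apply/finset.setP => u; rewrite !inE rvk.
    rewrite /gain (_ : B k.+1 = v |: B k); first by ring.
    by apply/finset.setP => u; rewrite !inE rv; case: (u =P v) => [->|]; rewrite ?vU ?orbF.
  have H u : (u \in U) && (enum_rank u < k.+1)%N = (u \in U) && (enum_rank u < k)%N.
    by rewrite rv; case: (u =P v) => [->|//]; rewrite (negPf vU).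
  rewrite (eq_bigl _ _ H) -IH; last exact: ltnW.
  by congr I; apply/finset.setP => u; rewrite !inE H.
have := E #|V| (leqnn _).
rewrite (_ : B #|V| = U); last by apply/finset.setP => u; rewrite inE ltn_ord andbT.
by move=> ->; apply: eq_bigl => v; rewrite ltn_ord andbT.
Qed.

Lemma chain_ge X U : X \subset U -> \sum_(v in X) gain v (before U v) <= I X.
Proof.
move=> XU; rewrite (chain_eq X); apply: ler_sum => v _; apply: gain_decr.
by apply/fintype.subsetP => u; rewrite !inE => /andP[/(fintype.subsetP XU) -> ->].
Qed.

Lemma I_le_sum X : I X <= \sum_(v in X) I [set v].
Proof.
rewrite chain_eq; apply: ler_sum => v _.
apply: le_trans (gain_decr v (finset.sub0set _)) _.
by rewrite /gain finset.setU0 I0 subr0.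
Qed.

End Submodular.

(** * The law of the acceptance sets *)

Section AcceptWeight.
Variables (R : realType) (V C : finType) (p : V -> C -> R).

Definition threshold_set (v : V) (S : {set C}) : set R :=
  [set s : R | (0 <= s <= 1) /\ (forall c, c \in S <-> s <= p v c)]%classic.

Lemma threshold_set_measurable v S : measurable (threshold_set v S).
Proof.
pose H (c : C) : set R :=
  if c \in S then `]-oo, p v c]%classic else `]p v c, +oo[%classic.
rewrite (_ : threshold_set v S =
  (`[0%R, 1%R]%classic `&` \bigcap_(c in [set: C]) H c)%classic); last first.
  apply/seteqP; split => s /=; rewrite in_itv /=.
    move=> [s01 sS]; split=> // c _; rewrite /H.
    case: ifPn => cS /=; rewrite in_itv /= ?andbT; first exact/sS.
    by rewrite ltNge; apply: contra cS => /sS.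
  move=> [s01 sS]; split=> // c; have := sS c Logic.I; rewrite /H.
  case: ifPn => cS /=; rewrite in_itv /= ?andbT; first by split.
  by rewrite ltNge => /negP nsc; split.
apply: measurableI; first exact: measurable_itv.
apply: fin_bigcap_measurable => [|c _]; first exact: finite_finset.
by rewrite /H; case: ifP => _; exact: measurable_itv.
Qed.

(** The threshold sets partition the unit interval: [s] belongs to the one of [S =
    [set c | s <= p v c]] and to no other. *)
Lemma sum_threshold_measure v :
  (\sum_(S : {set C}) lebesgue_measure (threshold_set v S))%E = 1%:E.
Proof.
transitivity (lebesgue_measure (`[0%R, 1%R]%classic : set R)); last first.
  by rewrite lebesgue_measure_itv /= lte_fin ltr01 oppr0 adde0.
rewrite (_ : `[0%R, 1%R]%classic =
  (\bigcup_(S in [set: {set C}]) threshold_set v S)%classic); last first.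
  apply/seteqP; split => s /=; rewrite in_itv /=.
    move=> s01; exists [set c | s <= p v c] => //; split => // c.
    by rewrite inE.
  by case=> S _ [].
rewrite measure_fin_bigcup.
- rewrite (@fsbigE _ _ _ _ _ (index_enum {set C})) ?index_enum_uniq //=.
    by apply: eq_bigl => S; rewrite in_setT.
  by move=> S _ /=; rewrite mem_index_enum.
- exact: finite_finset.
- apply/trivIsetP => S S' _ _ /eqP SS'; apply/seteqP; split => // s [] [_ sS] [_ sS'].
  by apply: SS'; apply/finset.setP => c; apply/idP/idP => [/sS/sS'|/sS'/sS].
- by move=> S _; exact: threshold_set_measurable.
Qed.

Lemma accept_weight_stochastic : stochastic (accept_weight p).
Proof.
split=> [v S|v]; first by rewrite /accept_weight fine_ge0.
rewrite /accept_weight sum_fine => [|S _].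
  by rewrite (sum_threshold_measure v).
rewrite fin_num_abs gee0_abs // -/(threshold_set v S).
apply: (@le_lt_trans _ _ 1%:E); last exact: ltry.
rewrite -(sum_threshold_measure v) (bigD1 S) //=.
by rewrite leeDl // sume_ge0.
Qed.

Lemma accept_weight_gt0 v S : 0 < accept_weight p v S ->
  exists s : R, forall c, c \in S <-> s <= p v c.
Proof.
move=> w0; have [D0|/eqP/set0P[s [_ sS]]] := pselect (threshold_set v S = classical_sets.set0); last by exists s.
by move: w0; rewrite /accept_weight -/(threshold_set v S) D0 measure0 ltxx.
Qed.

End AcceptWeight.

(** * Marginal values of actions *)

Section Acceptance.
Variables (R : realType) (V C : finType).
Variables (cv : C -> R) (p : V -> C -> R) (I : {set V} -> R).
Hypothesis I0 : I finset.set0 = 0.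
Hypothesis Imono : forall A A' : {set V}, A \subset A' -> I A <= I A'.
Hypothesis Isub : forall A A' : {set V}, I (A :|: A') + I (A :&: A') <= I A + I A'.
Hypothesis cv0 : forall c, 0 <= cv c.

Notation mu := (accept_weight p).
Notation E := (PE mu).
Let sm : stochastic mu := accept_weight_stochastic p.

Implicit Types (psi S : {set C}) (w : realization V C) (s : act V C)
  (A : {set act V C}) (v u : V) (y : act V C -> R).

Lemma first_acc_Some psi S c : first_acc cv psi S = Some c ->
  [/\ c \in psi, c \in S & forall c', c' \in psi -> c' \in S -> cv c <= cv c'].
Proof.
rewrite /first_acc; set l := [seq c <- _ | _] => lc.
have ml c' : (c' \in l) = (c' \in S) && (c' \in psi).
  by rewrite mem_filter mem_sort mem_enum.
have sl : sorted (fun a b => cv a <= cv b) l.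
  apply: sorted_filter; first by move=> a b c'; exact: le_trans.
  by apply: sort_sorted => a b; exact: le_total.
case: l lc ml sl => [//|a l] [<-] ml /= sl.
have /andP[aS ap] : (a \in S) && (a \in psi) by rewrite -ml inE eqxx.
split=> // c' c'p c'S; have : c' \in a :: l by rewrite ml c'p c'S.
rewrite inE => /orP[/eqP -> //|]; move: c' {c'p c'S}; apply/allP.
by apply: order_path_min sl => x y z; exact: le_trans.
Qed.

Lemma first_acc_neq0 psi S :
  (first_acc cv psi S != None) = [exists c in psi, c \in S].
Proof.
apply/idP/existsP => [|[c /andP[cp cS]]].
  case E : (first_acc cv psi S) => [c|//] _.
  by have [cp cS _] := first_acc_Some E; exists c; rewrite cp.
rewrite /first_acc; set l := [seq c <- _ | _].
have : c \in l by rewrite mem_filter cS mem_sort mem_enum.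
by case: l.
Qed.

Lemma paid_ge0 psi S : 0 <= paid cv psi S.
Proof. by rewrite /paid; case: first_acc. Qed.

Lemma paid_le psi S c : c \in psi -> c \in S -> paid cv psi S <= cv c.
Proof.
move=> cp cS; rewrite /paid; case E : (first_acc _ _ _) => [a|//].
by have [_ _ ->] := first_acc_Some E.
Qed.

Lemma paid0 psi S : first_acc cv psi S == None -> paid cv psi S = 0.
Proof. by rewrite /paid => /eqP ->. Qed.

Lemma paid_le_bound psi S b : 0 <= b -> (forall c, c \in psi -> cv c <= b) ->
  paid cv psi S <= b.
Proof.
move=> b0 H; rewrite /paid; case E : (first_acc _ _ _) => [a|//].
by apply: H; have [] := first_acc_Some E.
Qed.

Definition acc s w : bool := first_acc cv s.2 (w s.1) != None.

Lemma accE s w : acc s w = (first_acc cv s.2 (w s.1) != None).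
Proof. by []. Qed.

Definition accepted A w : {set V} :=
  [set v | [exists s in A, (s.1 == v) && acc s w]].

Lemma acceptedP A w v :
  reflect (exists2 s, s \in A & (s.1 == v) && acc s w) (v \in accepted A w).
Proof. by rewrite inE; apply: exists_inP. Qed.

Lemma accepted_sub A A' w : A \subset A' -> accepted A w \subset accepted A' w.
Proof.
move=> /fintype.subsetP AA'; apply/fintype.subsetP => v /acceptedP[s /AA' sA H].
by apply/acceptedP; exists s.
Qed.

Lemma accepted_upd A w u S v : v != u ->
  (v \in accepted A (upd w u S)) = (v \in accepted A w).
Proof.
move=> vu; apply/acceptedP/acceptedP => -[s sA /andP[/eqP sv H]]; exists s => //;
  move: H; by rewrite /acc sv eqxx upd_neq.
Qed.

Lemma accepted_setU1_other A s w v : s.1 != v ->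
  (v \in accepted (s |: A) w) = (v \in accepted A w).
Proof.
move=> sv; apply/acceptedP/acceptedP => -[s' s'A H]; exists s' => //.
  move: s'A; rewrite in_setU1 => /orP[/eqP E1|//].
  by move: H; rewrite E1 (negPf sv).
by rewrite in_setU1 s'A orbT.
Qed.

Lemma accepted_setU1 A s w :
  accepted (s |: A) w = if acc s w then s.1 |: accepted A w else accepted A w.
Proof.
apply/finset.setP => v; have [sv|sv] := eqVneq s.1 v; last first.
  rewrite accepted_setU1_other //; case: ifP => // _.
  by rewrite in_setU1 eq_sym (negPf sv).
case: ifPn => [sw|sw].
  rewrite -sv in_setU1 eqxx /=; apply/acceptedP; exists s; first by rewrite in_setU1 eqxx.
  by rewrite eqxx.
apply/acceptedP/acceptedP => -[s' s'A H]; exists s' => //.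
  move: s'A; rewrite in_setU1 => /orP[/eqP E1|//].
  by move: H; rewrite E1 (negPf sw) andbF.
by rewrite in_setU1 s'A orbT.
Qed.

Lemma fSE A : fS cv p I A = E (fun w => I (accepted A w)).
Proof.
apply: eq_PE => w; congr I; apply/finset.setP => v; rewrite !inE.
by apply: eq_existsb => s; rewrite /acc; case: (s.1 =P v) => [->|]; rewrite ?andbF.
Qed.

Lemma fS_incr : set_incr (fS cv p I).
Proof.
move=> A A' AA'; rewrite !fSE; apply: PE_le => // w _.
exact/Imono/accepted_sub.
Qed.

(** Neither gain depends on the outcome of [v]. The first sums over the seeds to exactly
    [I (accepted A w)]; the second is smaller and bounds the effect of adding an action to [A]. *)
Definition gain_before v A w := gain I v (before (accepted A w) v).
Definition gain_others v A w := gain I v (accepted A w :\ v).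

Lemma gain_before_ge0 v A w : 0 <= gain_before v A w.
Proof. exact: gain_ge0. Qed.

Lemma gain_others_ge0 v A w : 0 <= gain_others v A w.
Proof. exact: gain_ge0. Qed.

Lemma gain_others_before v A w : gain_others v A w <= gain_before v A w.
Proof.
apply: gain_decr => //; apply/fintype.subsetP => u; rewrite !inE => /andP[-> uv].
by rewrite andbT; apply: contraTneq uv => ->; rewrite ltnn.
Qed.

Lemma indep_gain_before v A : indep v (gain_before v A).
Proof.
move=> w S; congr (gain I v _); apply/finset.setP => u.
rewrite !in_before; have [->|uv] := eqVneq u v; first by rewrite !ltnn !andbF.
by rewrite (accepted_upd A w S uv).
Qed.

Lemma indep_gain_others v A : indep v (gain_others v A).
Proof.
move=> w S; congr (gain I v _); apply/finset.setP => u.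
rewrite !in_setD1; have [//|uv /=] := eqVneq u v.
by rewrite (accepted_upd A w S uv).
Qed.

Lemma gain_before_setU1 s A w : gain_before s.1 (s |: A) w = gain_before s.1 A w.
Proof.
congr (gain I _ _); apply/finset.setP => u.
rewrite !in_before; have [->|uv] := eqVneq u s.1; first by rewrite !ltnn !andbF.
by rewrite accepted_setU1_other // eq_sym.
Qed.

Definition acc_prob s : R := E (fun w => (acc s w)%:R).

Lemma acc_prob_ge0 s : 0 <= acc_prob s.
Proof. by apply: PE_ge0. Qed.

Lemma acc_indep s (g : realization V C -> R) : indep s.1 g ->
  E (fun w => (acc s w)%:R * g w) = acc_prob s * E g.
Proof.
exact: (@PE_indepM _ _ _ _ _ (fun S => (first_acc cv s.2 S != None)%:R)).
Qed.

Lemma I_accepted A w :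
  I (accepted A w) = \sum_v (v \in accepted A w)%:R * gain_before v A w.
Proof.
rewrite (chain_eq I0) big_mkcond; apply: eq_bigr => v _.
by case: (v \in _); rewrite ?mul1r ?mul0r.
Qed.

(** If [s.1] is not yet a seed, acceptance of [s] brings the full gain. If she is, nothing is
    gained, and the subtracted term absorbs the first one. *)
Lemma fS_marginal_ge s A :
  acc_prob s * E (gain_others s.1 A)
    - E (fun w => (s.1 \in accepted A w)%:R * gain_others s.1 A w)
  <= fS cv p I (s |: A) - fS cv p I A.
Proof.
rewrite -acc_indep; last exact: indep_gain_others.
rewrite !fSE -!PEB; apply: PE_le => // w _.
rewrite accepted_setU1 /gain_others; set U := accepted A w.
have g0 : 0 <= gain I s.1 (U :\ s.1) by exact: gain_ge0.
have [vU|vU] := boolP (s.1 \in U).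
  rewrite (finset.setUidPr _) ?finset.sub1set // if_same subrr.
  by case: (acc s w); rewrite ?mul1r ?mul0r; lra.
have -> : U :\ s.1 = U.
  apply/finset.setP => u; rewrite in_setD1; case: (u =P s.1) => [->|//].
  by rewrite (negPf vU).
by case: (acc s w); rewrite /gain ?mul1r ?mul0r; lra.
Qed.

Definition Fext y := EB y (fS cv p I).

Definition others_mean y v := EB y (fun A => E (gain_others v A)).

Definition others_loss y v :=
  EB y (fun A => E (fun w => (v \in accepted A w)%:R * gain_others v A w)).

Lemma others_loss_ge0 y v : unit_valued y -> 0 <= others_loss y v.
Proof.
move=> y01; apply: EB_ge0 => // A; apply: PE_ge0 => // w.
by apply: mulr_ge0 => //; exact: gain_others_ge0.
Qed.

Lemma sum_others_loss y : unit_valued y -> \sum_v others_loss y v <= Fext y.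
Proof.
move=> y01; rewrite -EB_sum; apply: EB_le => // A.
rewrite -PE_sum fSE; apply: PE_le => // w _.
rewrite I_accepted; apply: ler_sum => v _; apply: ler_wpM2l => //.
exact: gain_others_before.
Qed.

Lemma marginal_ge y s : unit_valued y ->
  acc_prob s * others_mean y s.1 - others_loss y s.1
    <= EB y (fun A => fS cv p I (s |: A)) - Fext y.
Proof.
move=> y01; rewrite -EBZ -!EBB; apply: EB_le => // A; exact: fS_marginal_ge.
Qed.

(** [W] and [accepted A] are evaluated at independent realizations [w] and [w'], so the probability
    of [v \in W w] factors out of the gain of [v]. Pointwise the bound is [union_le]. *)
Lemma random_set_le y (W : realization V C -> {set V}) : unit_valued y ->
  E (fun w => I (W w)) <=
    Fext y + \sum_v E (fun w => (v \in W w)%:R) * others_mean y v.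
Proof.
move=> y01; under eq_bigr => v _ do rewrite -PEZr.
rewrite -PE_sum -[Fext y](PE_const _ sm) -PED; apply: PE_le => // w _.
rewrite -[leLHS](EB_const _ y01) /Fext.
under eq_bigr => v _ do rewrite -EBZ.
rewrite -EB_sum -EBD; apply: EB_le => // A.
rewrite fSE; under eq_bigr => v _ do rewrite -PEZ.
rewrite -PE_sum -PED -[leLHS](PE_const _ sm); apply: PE_le => // w' _.
apply: le_trans (Imono (finset.subsetUr (accepted A w') _)) _.
apply: le_trans (union_le Imono Isub _ _) _; rewrite lerD2l big_mkcond.
apply: ler_sum => v _; case: (v \in W w); rewrite ?mul1r ?mul0r //.
by apply: gain_decr => //; apply/fintype.subsetP => u; rewrite in_setD1 => /andP[].
Qed.

(* A fresh copy of the realization decouples the seeds of A from W, which costs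
   one Fext y; the other is lost since users already seeded by A bring no
   marginal value when offered again. *)
Lemma marginals_dominate y (z : act V C -> R) (W : realization V C -> {set V}) :
  unit_valued y -> (forall s, 0 <= z s) ->
  (forall v, \sum_psi z (v, psi) <= 1) ->
  (forall v, \sum_psi z (v, psi) * acc_prob (v, psi) = E (fun w => (v \in W w)%:R)) ->
  E (fun w => I (W w)) - 2 * Fext y <=
    \sum_s z s * (EB y (fun A => fS cv p I (s |: A)) - Fext y).
Proof.
move=> y01 z0 z1 zW.
have le1 := random_set_le W y01.
have le2 := sum_others_loss y01.
have : \sum_s z s * (acc_prob s * others_mean y s.1 - others_loss y s.1) <=
    \sum_s z s * (EB y (fun A => fS cv p I (s |: A)) - Fext y).
  by apply: ler_sum => s _; apply: ler_wpM2l => //; exact: marginal_ge.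
rewrite (_ : \sum_s z s * (acc_prob s * others_mean y s.1 - others_loss y s.1) =
  \sum_v \sum_psi z (v, psi) * (acc_prob (v, psi) * others_mean y v - others_loss y v));
  last by rewrite pair_bigA; apply: eq_bigr => -[].
have : \sum_v (E (fun w => (v \in W w)%:R) * others_mean y v - others_loss y v) <=
  \sum_v \sum_psi z (v, psi) * (acc_prob (v, psi) * others_mean y v - others_loss y v).
  apply: ler_sum => v _.
  under [leRHS]eq_bigr => psi _ do rewrite mulrBr mulrA.
  rewrite sumrB -!mulr_suml zW lerD2l lerN2.
  by rewrite -[leRHS]mul1r; apply: ler_wpM2r => //; exact: others_loss_ge0.
rewrite sumrB; lra.
Qed.

End Acceptance.

(** * Rounding and budgeted execution *)

Section AlgorithmI.
Variables (R : realType) (V C : finType).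
Variables (cv : C -> R) (p : V -> C -> R) (I : {set V} -> R) (K : nat) (B beta : R).
Hypothesis I0 : I finset.set0 = 0.
Hypothesis Imono : forall A A' : {set V}, A \subset A' -> I A <= I A'.
Hypothesis Isub : forall A A' : {set V}, I (A :|: A') + I (A :&: A') <= I A + I A'.
Hypothesis cv0 : forall c, 0 <= cv c.
Hypothesis B0 : 0 <= B.

Notation mu := (accept_weight p).
Notation E := (PE mu).
Let sm : stochastic mu := accept_weight_stochastic p.

Implicit Types (psi S : {set C}) (w : realization V C) (s : act V C)
  (A Z : {set act V C}) (v u : V) (y : act V C -> R).

Notation acc := (acc cv).
Notation accepted := (accepted cv).
Notation gain_before := (gain_before cv I).

Lemma ER_EB y (g : {set act V C} -> R) :
  (forall s, s \notin Sact V cv K B -> y s = 0) -> ER cv K B y g = EB y g.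
Proof.
move=> y0; rewrite /ER EB_sumE big_mkcond; apply: eq_bigr => A _.
case: ifPn => [/fintype.subsetP AS|/subsetPn[s sA sS]].
  congr (_ * _); rewrite /probR big_mkcond; apply: eq_bigr => s _.
  by case: ifPn => // sS; rewrite ifN ?y0 ?subr0 //; apply: contra sS; exact: AS.
by rewrite (bigD1 s) //= sA y0 // !mul0r.
Qed.

(* A condition on A rather than on Z, and on the other users only: it guarantees
   execution in every order and is independent of the outcome of v. *)
Definition kept v A w : bool :=
  \sum_(s in A | s.1 != v) paid cv s.2 (w s.1) <= B / 2.

Lemma exec_sub w l rem (U : {set V}) : U \subset exec cv B w rem l U.
Proof.
elim: l rem U => [|s l IH] rem U //=.
case: ifP => _; last exact: IH.
apply: fintype.subset_trans (IH _ _); case: first_acc => // _; exact: finset.subsetUr.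
Qed.

(** Each user occurs once in [l], so only payments to other users are deducted before [s] is
    reached, and at least [B / 2] is left by then. *)
Lemma exec_accepts w l rem (U : {set V}) s :
  uniq [seq x.1 | x <- l] -> s \in l -> acc s w ->
  \sum_(x <- l | x.1 != s.1) paid cv x.2 (w x.1) <= rem - B / 2 ->
  s.1 \in exec cv B w rem l U.
Proof.
elim: l rem U => [//|a l IH] rem U /= /andP[al ul] sl sw; rewrite big_cons.
have S0 : 0 <= \sum_(x <- l | x.1 != s.1) paid cv x.2 (w x.1).
  by apply: sumr_ge0 => x _; exact: paid_ge0.
have [sa|sa] := eqVneq s a.
  rewrite -sa eqxx /= => H; rewrite ifT; last by move: S0 H; lra.
  apply: (fintype.subsetP (exec_sub _ _ _ _)); move: sw; rewrite accE.
  by case: first_acc => // c _; rewrite in_setU1 eqxx.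
have {}sl : s \in l by move: sl; rewrite inE (negPf sa).
rewrite ifT => [H|]; last first.
  by apply: contraNneq al => ->; apply: map_f.
have p0 := paid_ge0 cv0 a.2 (w a.1).
by case: ifP => _; apply: IH => //; lra.
Qed.

(** Accepted kept actions of [Z] are executed in any order. Their users lie in [accepted A w], so
    [chain_ge] bounds their gains measured in that larger set. *)
Lemma exec_value w A Z l : Z \subset A ->
  (forall v, (#|[set s in Z | s.1 == v]| <= 1)%N) -> perm_eq l (enum Z) ->
  \sum_(s in Z) (acc s w)%:R * ((kept s.1 A w)%:R * gain_before s.1 A w)
    <= I (exec cv B w B l finset.set0).
Proof.
move=> ZA Z1 lZ.
pose Z' := [set s in Z | acc s w && kept s.1 A w].
have injZ : {in Z &, injective (fun s : act V C => s.1)}.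
  move=> s s' sZ s'Z ss'; apply/eqP; apply: contraTT (Z1 s.1) => ns.
  rewrite -ltnNge; apply/card_gt1P; exists s, s'.
  by split => //; rewrite inE ?sZ ?s'Z ?eqxx //= ss' eqxx.
have Z'Z : Z' \subset Z by apply/fintype.subsetP => s; rewrite inE => /andP[].
have memT v : v \in [set s.1 | s in Z'] ->
    v \in accepted A w /\ v \in exec cv B w B l finset.set0.
  case/imsetP => s; rewrite inE => /and3P[sZ sw ks] ->; split.
    apply/acceptedP; exists s; first exact: (fintype.subsetP ZA).
    by rewrite eqxx.
  apply: exec_accepts => //.
  - rewrite map_inj_in_uniq ?(perm_uniq lZ) ?enum_uniq //.
    by move=> a b; rewrite !(perm_mem lZ) !mem_enum; exact: injZ.
  - by rewrite (perm_mem lZ) mem_enum.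
  rewrite (perm_big _ lZ) /= big_enum_cond /=.
  apply: (@le_trans _ _ (B / 2)); last by lra.
  apply: le_trans ks; rewrite [leLHS]big_mkcond [leRHS]big_mkcond.
  apply: ler_sum => x _; case: ifP => [/andP[xZ xs]|_].
    by rewrite (fintype.subsetP ZA _ xZ) xs.
  by case: ifP => // _; exact: paid_ge0.
apply: (@le_trans _ _ (I [set s.1 | s in Z'])); last first.
  by apply: Imono; apply/fintype.subsetP => v /memT[].
have TA : [set s.1 | s in Z'] \subset accepted A w.
  by apply/fintype.subsetP => v /memT[].
apply: le_trans (chain_ge I0 Imono Isub TA).
rewrite (big_imset (fun v => gain I v (before (accepted A w) v))) /=; last first.
  by move=> a b /(fintype.subsetP Z'Z) aZ /(fintype.subsetP Z'Z); exact: injZ.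
rewrite [leLHS]big_mkcond [leRHS]big_mkcond; apply: ler_sum => s _; rewrite inE.
case: (s \in Z) => //=; case: (acc s w); case: (kept s.1 A w);
  rewrite /= ?mul0r ?mul1r ?mul0r //.
Qed.

Definition kept_mean v A := E (fun w => (kept v A w)%:R).
Definition before_mean v A := E (gain_before v A).

Definition spent A u S : R := \sum_(s in A | s.1 == u) paid cv s.2 S.

(* Outcomes of a user are ordered by "rejects before accepts, then by payment":
   both her becoming a seed and her payment are monotone for this order, whereas
   her payment is not monotone in her threshold. *)
Definition outcome_le A u S S' : bool :=
  ~~ [exists s in A, (s.1 == u) && (first_acc cv s.2 S != None)] ||
  ([exists s in A, (s.1 == u) && (first_acc cv s.2 S' != None)] &&
   (spent A u S <= spent A u S')).

Lemma outcome_le_total A u : total (outcome_le A u).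
Proof.
move=> S S'; rewrite /outcome_le.
by do 2 case: existsP => _ //=; exact: le_total.
Qed.

Lemma spent_le A u S S' : outcome_le A u S S' -> spent A u S <= spent A u S'.
Proof.
case/orP => [H|/andP[_ //]].
rewrite [leLHS]big1 => [|s /andP[sA su]]; first by apply: sumr_ge0 => s _; exact: paid_ge0.
apply: paid0; apply: contraNT H => H; apply/existsP; exists s.
by rewrite sA su.
Qed.

Lemma decr_kept v A : decr (outcome_le A) (fun w => (kept v A w)%:R : R).
Proof.
move=> w u S S' r; rewrite ler_nat.
suff : kept v A (upd w u S') -> kept v A (upd w u S) by case: kept => // ->.
apply: le_trans; rewrite (bigID (fun s => s.1 == u)) [leRHS](bigID (fun s => s.1 == u)) /=.
apply: lerD; last first.
  by apply: ler_sum => s /andP[_ su]; rewrite !upd_neq.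
have [->|uv] := eqVneq u v.
  by rewrite !big1 // => s /andP[/andP[_ /negPf ->]].
have D S0 : \sum_(s in A | (s.1 != v) && (s.1 == u)) paid cv s.2 (upd w u S0 s.1) =
    spent A u S0.
  apply: eq_big => s; first by case: (s.1 =P u) => [->|]; rewrite ?uv ?andbF.
  by move=> /and3P[_ _ /eqP ->]; rewrite upd_same.
under eq_bigl => s do rewrite -andbA.
under [leRHS]eq_bigl => s do rewrite -andbA.
by rewrite !D; exact: spent_le.
Qed.

Lemma decr_gain_before v A : decr (outcome_le A) (gain_before v A).
Proof.
move=> w u S S' r; apply: gain_decr => //; apply/fintype.subsetP => x.
rewrite !in_before => /andP[xA ->]; rewrite andbT.
have [xu|xu] := eqVneq x u; last by move: xA; rewrite !accepted_upd.
move: xA r; rewrite xu => /acceptedP[s sA /andP[/eqP su]].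
rewrite accE su upd_same => H /orP[/negP[]|].
  by apply/existsP; exists s; rewrite sA su eqxx.
case/andP => /existsP[s' /and3P[s'A s'u s'S]] _.
apply/acceptedP; exists s' => //; rewrite s'u /=.
by rewrite accE (eqP s'u) upd_same.
Qed.

Lemma indep_kept v A : indep v (fun w => (kept v A w)%:R : R).
Proof.
move=> w S; congr ((nat_of_bool (_ <= _))%:R).
by apply: eq_bigr => s /andP[_ sv]; rewrite upd_neq.
Qed.

Lemma kept_gain_mean s A :
  acc_prob cv p s * (kept_mean s.1 A * before_mean s.1 A) <=
  E (fun w => (acc s w)%:R * ((kept s.1 A w)%:R * gain_before s.1 A w)).
Proof.
rewrite acc_indep; last first.
  move=> w S; congr (_ * _); first exact: indep_kept.
  exact: indep_gain_before.
apply: ler_wpM2l; first exact: acc_prob_ge0.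
apply: (harris sm (outcome_le_total A)); [exact: decr_kept | exact: decr_gain_before].
Qed.

Lemma kept_setU1 s A w : kept s.1 (s |: A) w = kept s.1 A w.
Proof.
congr (_ <= _); apply: eq_bigl => x; rewrite in_setU1.
by case: (x =P s) => [->|//]; rewrite eqxx !andbF.
Qed.

Lemma kept_mean_decr v : set_decr (kept_mean v).
Proof.
move=> A A' /fintype.subsetP AA'; apply: PE_le => // w _; rewrite ler_nat.
suff : kept v A' w -> kept v A w by case: kept => // ->.
apply: le_trans; rewrite [leLHS]big_mkcond [leRHS]big_mkcond.
apply: ler_sum => x _; case: ifP => [/andP[xZ xs]|_].
  by rewrite (AA' _ xZ) xs.
by case: ifP => // _; exact: paid_ge0.
Qed.

Lemma before_mean_decr v : set_decr (before_mean v).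
Proof.
move=> A A' AA'; apply: PE_le => // w _; apply: gain_decr => //.
apply/fintype.subsetP => x; rewrite !in_before => /andP[xA ->]; rewrite andbT.
exact: (fintype.subsetP (accepted_sub cv w AA')).
Qed.

Lemma kept_mean_ge0 v A : 0 <= kept_mean v A.
Proof. by apply: PE_ge0. Qed.

Lemma before_mean_ge0 v A : 0 <= before_mean v A.
Proof. by apply: PE_ge0 => // w; exact: gain_before_ge0. Qed.

(** * Rounding a fractional point that satisfies the expected budget *)

Section RoundedPoint.
Variables (y : act V C -> R) (crs : {set act V C} -> {set act V C} -> R) (c : R).
Hypothesis y01 : unit_valued y.
Hypothesis ysupp : forall s, s \notin Sact V cv K B -> y s = 0.
Hypothesis ybudget : \sum_s y s * bcost cv p s <= beta * B.
Hypothesis beta0 : 0 <= beta.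

(** Markov's inequality at level [B / 2] for the total payment of all actions of the random set,
    whose mean is at most [beta * B]. *)
Lemma kept_prob v : 1 - 2 * beta <= EB y (kept_mean v).
Proof.
(* Markov's inequality is void for [B = 0]; then all coupons of [Cl] are worth 0 and every user is
   kept. *)
have [BE|Bn] := eqVneq B 0.
  apply: (@le_trans _ _ 1); first by move: beta0; lra.
  rewrite -[leLHS](EB_const 1 y01); apply: EB_le_support => // A yA.
  rewrite -[leLHS](PE_const 1 sm); apply: PE_le => // w _.
  rewrite ler1n lt0b /kept big1 ?BE ?mul0r // => s /andP[sA _].
  apply: le_anti; rewrite paid_ge0 // andbT.
  have : s \in Sact V cv K B.
    by apply: contraTT (yA s sA) => sS; rewrite ysupp // ltxx.
  rewrite inE inE => /andP[/fintype.subsetP sC _].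
  by apply: paid_le_bound => // x /sC; rewrite inE BE mul0r.
have Bp : 0 < B by rewrite lt_neqAle eq_sym Bn.
have H : B / 2 * (1 - EB y (kept_mean v)) <= beta * B.
  apply: le_trans ybudget; rewrite -EB_card_sum // -[X in _ * (X - _)](EB_const 1 y01) -EBB -EBZ.
  apply: EB_le => // A; rewrite -[X in _ * (X - _)](PE_const 1 sm) -PEB -PEZ -PE_sum.
  apply: PE_le => // w _.
  have T0 (P : pred (act V C)) : 0 <= \sum_(s | P s) paid cv s.2 (w s.1).
    by apply: sumr_ge0 => s _; exact: paid_ge0.
  have [k|] := boolP (kept v A w); first by rewrite subrr mulr0.
  rewrite /kept -ltNge subr0 mulr1 => /ltW k; apply: le_trans k _.
  rewrite [leRHS](bigID (fun s => s.1 != v)) /= lerDl; exact: T0.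
by nra.
Qed.

(** A seed is counted once for each of her accepted actions in the random set, hence at least once.
    Membership of [s] is independent of [before_mean s.1], which ignores actions of [s.1]. *)
Lemma Fext_le_sum :
  Fext cv p I y <= \sum_s y s * (acc_prob cv p s * EB y (before_mean s.1)).
Proof.
apply: (@le_trans _ _ (EB y (fun A => \sum_s
   (if s \in A then acc_prob cv p s * before_mean s.1 A else 0)))).
  apply: EB_le => // A; rewrite fSE.
  rewrite (eq_PE _ (I_accepted cv I0 A)).
  apply: (@le_trans _ _ (E (fun w => \sum_(s in A) (acc s w)%:R * gain_before s.1 A w))).
    apply: PE_le => // w _.
    rewrite [leRHS](partition_big (fun s : act V C => s.1) predT) //=.
    apply: ler_sum => v _.
    have T0 (P : pred (act V C)) : 0 <= \sum_(s | P s) (acc s w)%:R * gain_before s.1 A w.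
      by apply: sumr_ge0 => s _; apply: mulr_ge0 => //; exact: gain_before_ge0.
    have [/acceptedP[s sA /andP[sv sw]]|_] := boolP (v \in accepted A w); last first.
      by rewrite mul0r.
    by rewrite (bigD1 s) ?sA ?sv //= sw (eqP sv) lerDl.
  rewrite PE_sum -big_mkcond; apply: ler_sum => s _.
  by rewrite acc_indep //; exact: indep_gain_before.
rewrite EB_sum; apply: ler_sum => s _.
rewrite (EB_in (fun A => acc_prob cv p s * before_mean s.1 A)) // EBZ.
by rewrite (eq_EB _ (fun A => eq_PE _ (gain_before_setU1 cv I s A))).
Qed.

Hypothesis c0 : 0 <= c.
Hypothesis beta12 : beta <= 1 / 2.
Hypothesis crsP : is_crs y crs.
Hypothesis crs_bal : crs_balanced cv K B c y crs.
Hypothesis crs_mon : crs_monotone crs.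

Lemma psel_ge0 A s : 0 <= psel crs A s.
Proof. by apply: sumr_ge0 => Z _; have [] := crsP A. Qed.

(** Given [s \in A], Harris' inequality on the remaining bits separates three decreasing factors:
    selection contributes [c], being kept [1 - 2 * beta], and the gains sum to at least [Fext] by
    [Fext_le_sum]. *)
Lemma algI_ge (ord : {set act V C} -> seq (act V C)) :
  (forall Z, perm_eq (ord Z) (enum Z)) ->
  c * (1 - 2 * beta) * Fext cv p I y <= algI_value cv p I K B y crs ord.
Proof.
move=> ordP; rewrite /algI_value (ER_EB _ ysupp).
pose h s A w := (acc s w)%:R * ((kept s.1 A w)%:R * gain_before s.1 A w).
have Eh0 s A : 0 <= E (h s A).
  apply: PE_ge0 => // w; apply: mulr_ge0 => //; apply: mulr_ge0 => //.
  exact: gain_before_ge0.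
apply: (@le_trans _ _ (EB y (fun A => \sum_s if s \in A then
    psel crs A s * (acc_prob cv p s * (kept_mean s.1 A * before_mean s.1 A)) else 0))); last first.
  apply: EB_le => // A; have [cr0 [cr1 crZ]] := crsP A.
  apply: (@le_trans _ _ (\sum_s psel crs A s * E (h s A))).
    apply: ler_sum => s _; case: ifP => _.
      by apply: ler_wpM2l; [exact: psel_ge0 | exact: kept_gain_mean].
    by apply: mulr_ge0 => //; exact: psel_ge0.
  rewrite /psel; under eq_bigr => s _ do rewrite mulr_suml big_mkcond.
  rewrite exchange_big /=; apply: ler_sum => Z _.
  rewrite -big_mkcond -mulr_sumr /=.
  have := cr0 Z; rewrite le_eqVlt => /orP[/eqP <-|crp]; first by rewrite !mul0r.
  have [ZA Z1] := crZ Z crp.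
  apply: ler_wpM2l => //; rewrite -PE_sum; apply: PE_le => // w _.
  apply: exec_value => //.
  by apply: fintype.subset_trans ZA _; exact: finset.subsetIl.
rewrite EB_sum.
apply: (le_trans (ler_wpM2l _ Fext_le_sum)); first by apply: mulr_ge0 => //; move: beta12; lra.
rewrite mulr_sumr; apply: ler_sum => s _.
rewrite (EB_in (fun A => psel crs A s * (acc_prob cv p s * (kept_mean s.1 A * before_mean s.1 A)))) //.
have hb0 : 0 <= EB y (before_mean s.1) by apply: EB_ge0 => // A; exact: before_mean_ge0.
have q0 := acc_prob_ge0 cv p s.
have /andP[ys0 _] := y01 s.
pose ps A := psel crs (s |: A) s.
have ps0 : 0 <= EB y ps by apply: EB_ge0 => // A; exact: psel_ge0.
(* Balancedness, with membership of [s] turned into the factor [y s]. *)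
have bal : c * y s <= y s * EB y ps.
  move: ys0; rewrite le_eqVlt => /orP[/eqP <-|ysp]; first by rewrite mulr0 mul0r.
  have sS : s \in Sact V cv K B.
    by apply: contraTT ysp => sS; rewrite ysupp // ltxx.
  by have := crs_bal sS ysp; rewrite (ER_EB _ ysupp) (EB_in (fun A => psel crs A s)).
have dps : set_decr ps.
  move=> A A' AA'; apply: crs_mon; first by rewrite in_setU1 eqxx.
  exact: finset.setUS.
have dkb : set_decr (fun A => kept_mean s.1 A * before_mean s.1 A).
  move=> A A' AA'; apply: ler_pM; [exact: kept_mean_ge0|exact: before_mean_ge0| |].
    exact: kept_mean_decr.
  exact: before_mean_decr.
have H1 := EB_harris y01 (@kept_mean_decr s.1) (@before_mean_decr s.1).
have H2 := EB_harris y01 dps dkb.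
rewrite [X in _ <= _ * X](_ : _ = acc_prob cv p s * EB y (fun A => ps A * (kept_mean s.1 A * before_mean s.1 A))).
  have k := kept_prob s.1.
  have H3 : (1 - 2 * beta) * EB y (before_mean s.1) <=
      EB y (fun A => kept_mean s.1 A * before_mean s.1 A).
    by apply: le_trans H1; apply: ler_wpM2r.
  have H4 := ler_wpM2l ps0 H3.
  have H5 := le_trans H4 H2.
  have H6 := ler_wpM2l (mulr_ge0 ys0 q0) H5.
  have kb0 : 0 <= (1 - 2 * beta) * EB y (before_mean s.1).
    by apply: mulr_ge0 => //; move: beta12; lra.
  have H7 := ler_wpM2r (mulr_ge0 q0 kb0) bal.
  rewrite [leRHS]mulrA; apply: le_trans; last exact: H6.
  rewrite [leLHS](_ : _ = c * y s * (acc_prob cv p s * ((1 - 2 * beta) * EB y (before_mean s.1)))); last by ring.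
  by apply: le_trans H7 _; rewrite le_eqVlt; apply/orP; left; apply/eqP; ring.
rewrite -EBZ; apply: eq_EB => A.
rewrite /before_mean (eq_PE _ (gain_before_setU1 cv I s A)).
rewrite (_ : kept_mean s.1 (s |: A) = kept_mean s.1 A); first by rewrite /ps; ring.
by apply: eq_PE => w; rewrite kept_setU1.
Qed.

End RoundedPoint.
End AlgorithmI.

(** * Adaptive policies and ALG II *)

Section Runs.
Variables (V C : finType) (K : nat) (pi : policy V C).
Implicit Types (w : realization V C) (h : hist V C) (v : V).

Lemma run_cat w n h : exists t, run pi w n h = h ++ t.
Proof.
elim: n h => [|n IH] h /=; first by exists [::]; rewrite cats0.
case: (pi h) => [a|]; last by exists [::]; rewrite cats0.
have [t ->] := IH (rcons h (a, a.2 \in w a.1)); eexists; exact: cat_rcons.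
Qed.

Definition no_accept w v (e : V * C * bool) : bool :=
  (e.1.1 == v) ==> (e.1.2 \notin w v) && ~~ e.2.

(** A coupling: the run on [w] and the run where [v] rejects everything coincide until [v] first
    accepts in [w]. *)
Lemma run_reject w v n h :
  (exists t, [/\ run pi (upd w v finset.set0) n h = h ++ t, run pi w n h = h ++ t &
     all (no_accept w v) t]) \/
  (exists t c t0 t1, [/\ run pi (upd w v finset.set0) n h = h ++ t ++ (v, c, false) :: t0,
     run pi w n h = h ++ t ++ (v, c, true) :: t1, c \in w v & all (no_accept w v) t]).
Proof.
elim: n h => [|n IH] h /=; first by left; exists [::]; rewrite cats0.
case: (pi h) => [[u c]|] /=; last by left; exists [::]; rewrite cats0.
have [uv|uv] := eqVneq u v; last first.
  rewrite upd_neq //; set e := (u, c, _).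
  have ne : no_accept w v e by rewrite /no_accept (negPf uv).
  have [[t [E1 E2 at_]]|[t [a [t0 [t1 [E1 E2 av at_]]]]]] := IH (rcons h e).
    by left; exists (e :: t); rewrite E1 E2 cat_rcons /= ne.
  by right; exists (e :: t), a, t0, t1; rewrite E1 E2 !cat_rcons /= ne.
rewrite uv upd_same finset.in_set0.
have [cv|cv] := boolP (c \in w v).
  right; have [t0 ->] := run_cat (upd w v finset.set0) n (rcons h (v, c, false)).
  have [t1 ->] := run_cat w n (rcons h (v, c, true)).
  by exists [::], c, t0, t1; rewrite !cat_rcons.
set e := (v, c, _).
have ne : no_accept w v e by rewrite /no_accept eqxx cv.
have [[t [E1 E2 at_]]|[t [a [t0 [t1 [E1 E2 av at_]]]]]] := IH (rcons h e).
  by left; exists (e :: t); rewrite E1 E2 cat_rcons /= ne.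
by right; exists (e :: t), a, t0, t1; rewrite E1 E2 !cat_rcons /= ne.
Qed.

(* The coupons v is offered as long as she rejects: they do not depend on her own
   threshold, whatever the policy does with her answers. *)
Definition offers v w : seq C :=
  [seq e.1.2 | e <- trace K pi (upd w v finset.set0) & e.1.1 == v].

Lemma offers_upd v w S : offers v (upd w v S) = offers v w.
Proof. by rewrite /offers upd_upd. Qed.

(** The realization where [v] rejects everything may have weight zero, so its run may probe her more
    than [K] times. The probe bound on [w] itself puts her first accepted coupon among the first [K]
    offers. *)
Lemma offersP w v : (probes v (trace K pi w) <= K)%N ->
  (forall c, c \in offers v w -> c \notin w v) /\ v \notin seeds (trace K pi w) \/
  exists c, [/\ c \in take K (offers v w), c \in w v & (v, c, true) \in trace K pi w].
Proof.
rewrite /offers /trace.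
have [[t [-> -> /allP at_]]|[t [c [t0 [t1 [-> -> cw _]]]]]] := run_reject w v (K * #|V|).+1 [::].
  move=> _; left; split=> [c|].
    case/mapP => e; rewrite mem_filter => /andP[ev et] ->.
    by have := at_ e et; rewrite /no_accept ev => /andP[].
  rewrite inE; apply/hasPn => e /at_; rewrite /no_accept.
  by case: (_ == v) => //= /andP[].
rewrite /probes /= count_cat /= eqxx => cK; right; exists c; split => //; last first.
  by rewrite mem_cat inE eqxx orbT.
rewrite filter_cat map_cat /= eqxx take_cat size_map size_filter ifN; last first.
  by rewrite -leqNgt; lia.
rewrite mem_cat; apply/orP; right.
have : (0 < K - count (fun e : V * C * bool => e.1.1 == v) t)%N by lia.
by case: (K - _)%N => [//|k] _ /=; rewrite inE eqxx.
Qed.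

End Runs.

(** * Small coupons, the exceptional seed, and the law of the offers *)

Section PolicyBound.
Variables (R : realType) (V C : finType).
Variables (cv : C -> R) (p : V -> C -> R) (I : {set V} -> R) (K : nat) (B : R).
Variables (cmax : C) (lst : seq V) (pi : policy V C).
Hypothesis I0 : I finset.set0 = 0.
Hypothesis Ige0 : forall A : {set V}, 0 <= I A.
Hypothesis Imono : forall A A' : {set V}, A \subset A' -> I A <= I A'.
Hypothesis Isub : forall A A' : {set V}, I (A :|: A') + I (A :&: A') <= I A + I A'.
Hypothesis cv0 : forall c, 0 <= cv c.
Hypothesis B0 : 0 <= B.
Hypothesis pmono : forall v c c', cv c <= cv c' -> p v c <= p v c'.
Hypothesis cmaxP : forall c, cv c <= cv cmax.
Hypothesis lstP : perm_eq lst (enum V).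
Hypothesis lst_sorted : sorted (fun a b => I [set b] <= I [set a]) lst.
Hypothesis piP : det_feasible cv p K B pi.

Notation mu := (accept_weight p).
Notation E := (PE mu).
Let sm : stochastic mu := accept_weight_stochastic p.
Implicit Types (w : realization V C) (v u : V) (psi : {set C}).

Definition algII_gain w : R :=
  I (if ohead [seq v <- lst | cmax \in w v] is Some v then [set v] else finset.set0).

Lemma algII_gain_ge w v : cmax \in w v -> I [set v] <= algII_gain w.
Proof.
move=> cw; rewrite /algII_gain; set l := [seq v <- lst | _].
have vl : v \in l by rewrite mem_filter cw (perm_mem lstP) mem_enum.
have sl : sorted (fun a b => I [set b] <= I [set a]) l.
  by apply: sorted_filter lst_sorted => a b c ba cb; exact: le_trans cb ba.
case: l vl sl => // a l; rewrite inE => /orP[/eqP -> //|vl] /= sl.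
have /allP/(_ v vl) // : all (fun b => I [set b] <= I [set a]) l.
by apply: order_path_min sl => x y z yx zy; exact: le_trans zy yx.
Qed.

(** Positive weight provides an actual threshold producing [w v], to which monotonicity of [p]
    applies. *)
Lemma accepts_upward w v c c' : 0 < rweight p w ->
  c \in w v -> cv c <= cv c' -> c' \in w v.
Proof.
move=> w0 cw cc'; have [m0 _] := sm.
have : 0 < accept_weight p v (w v).
  rewrite lt_neqAle m0 andbT eq_sym; apply: contraTneq w0 => H.
  by rewrite /rweight (bigD1 v) //= H mul0r ltxx.
case/accept_weight_gt0 => s sP; apply/sP; apply: le_trans (pmono v cc').
exact/sP.
Qed.

(** The order of the offers is forgotten: acceptance depends only on the set, and offering by
    increasing value pays the cheapest accepted coupon. *)
Definition small_offer v w : {set C} :=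
  [set c in take K (offers K pi v w) | c \in Cl cv B].

Definition small_seeds w : {set V} := [set v | acc cv (v, small_offer v w) w].

Lemma small_offer_upd v w S : small_offer v (upd w v S) = small_offer v w.
Proof. by rewrite /small_offer offers_upd. Qed.

Lemma small_offer_Psi v w : small_offer v w \in Psi cv K B.
Proof.
rewrite inE; apply/andP; split.
  by apply/fintype.subsetP => c; rewrite inE => /andP[].
apply: (@leq_trans (size (take K (offers K pi v w)))); last by rewrite size_take_min geq_minl.
apply: leq_trans (card_size _); apply: subset_leq_card.
by apply/fintype.subsetP => c; rewrite inE => /andP[].
Qed.

Lemma small_seedsP w v :
  reflect (exists c, [/\ c \in small_offer v w & c \in w v]) (v \in small_seeds w).
Proof.
rewrite inE accE first_acc_neq0; apply: (iffP existsP) => [[c /andP[]]|[c [cp cw]]].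
  by exists c.
by exists c; rewrite cp.
Qed.

Definition redeemed_by (tr : hist V C) v : R :=
  \sum_(e <- tr | e.2 && (e.1.1 == v)) cv e.1.2.

Lemma redeemedE tr : redeemed cv tr = \sum_v redeemed_by tr v.
Proof. by rewrite /redeemed (partition_big (fun e => e.1.1) predT). Qed.

Lemma redeemed_by_ge tr v c : (v, c, true) \in tr -> cv c <= redeemed_by tr v.
Proof.
move=> etr; rewrite /redeemed_by (big_rem _ etr) /= eqxx lerDl.
by apply: sumr_ge0 => e _.
Qed.

Lemma redeemed_by_ge0 tr v : 0 <= redeemed_by tr v.
Proof. by apply: sumr_ge0 => e _. Qed.

(* If the policy's first accepted coupon of v is not in C_l, it is still worth more
   than anything paid in small_offer v w. *)
Lemma small_paid_le w : 0 < rweight p w ->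
  \sum_v paid cv (small_offer v w) (w v) <= B.
Proof.
move=> w0; have [wK wB] := piP w0; apply: le_trans wB; rewrite redeemedE.
apply: ler_sum => v _.
have [vs|vs] := boolP (v \in small_seeds w); last first.
  rewrite paid0 ?redeemed_by_ge0 //.
  by move: vs; rewrite inE accE negbK.
have [[H _]|[c [cK cw ctr]]] := offersP (wK v).
  have /small_seedsP[c [cs cw]] := vs.
  have : c \in offers K pi v w.
    by move: cs; rewrite inE => /andP[/mem_take].
  by move=> /H; rewrite cw.
apply: le_trans (redeemed_by_ge ctr).
have [cl|cl] := boolP (c \in Cl cv B).
  by apply: paid_le => //; rewrite inE cK.
apply: (@le_trans _ _ (B / 2)); last by move: cl; rewrite inE -ltNge; exact: ltW.
apply: paid_le_bound; first by rewrite divr_ge0.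
by move=> x; rewrite 2!inE => /andP[_].
Qed.

Lemma large_seed w v : 0 < rweight p w -> v \in seeds (trace K pi w) ->
  v \notin small_seeds w ->
  cmax \in w v /\ B / 2 < redeemed_by (trace K pi w) v.
Proof.
move=> w0 vs vn; have [wK _] := piP w0.
have [[_]|[c [cK cw ctr]]] := offersP (wK v); first by rewrite vs.
split; first exact: accepts_upward cw (cmaxP c).
apply: lt_le_trans (redeemed_by_ge ctr); rewrite ltNge; apply: contra vn => cl.
by apply/small_seedsP; exists c; rewrite inE cK inE.
Qed.

(* Two users who accept coupons above B / 2 would exhaust the budget, so at most
   one seed is not in small_seeds w. *)
Lemma I_seeds_le w : 0 < rweight p w ->
  I (seeds (trace K pi w)) <= I (small_seeds w) + algII_gain w.
Proof.
move=> w0; pose L := seeds (trace K pi w) :\: small_seeds w.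
have sub : seeds (trace K pi w) \subset small_seeds w :|: L.
  by apply/fintype.subsetP => v vs; rewrite finset.in_setU finset.in_setD vs andbT orbN.
apply: le_trans (Imono sub) _.
have := Isub (small_seeds w) L; have := Ige0 (small_seeds w :&: L).
suff : I L <= algII_gain w by lra.
have L1 v : v \in L -> cmax \in w v /\ B / 2 < redeemed_by (trace K pi w) v.
  by rewrite finset.in_setD => /andP[vn vs]; exact: large_seed.
have [->|[v vL]] := finset.set_0Vmem L; first by rewrite I0 /algII_gain.
apply: le_trans (algII_gain_ge (L1 v vL).1); apply: Imono.
apply/fintype.subsetP => u uL; rewrite finset.in_set1; apply: contraT => uv.
have [_] := piP w0; rewrite redeemedE (bigD1 u) //= (bigD1 v) /=; last by rewrite eq_sym.
have : 0 <= \sum_(x | (x != u) && (x != v)) redeemed_by (trace K pi w) x.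
  by apply: sumr_ge0 => x _; exact: redeemed_by_ge0.
have := (L1 v vL).2; have := (L1 u uL).2.
by lra.
Qed.

Lemma det_value_le :
  det_value p I K pi <= E (fun w => I (small_seeds w)) + E algII_gain.
Proof. by rewrite -PED; apply: PE_le => // w; exact: I_seeds_le. Qed.

(** Any user who accepts some coupon accepts [cmax], so each seed alone is worth at most
    [algII_gain w]. This crude bound serves to absorb the discretization error. *)
Lemma small_value_le : E (fun w => I (small_seeds w)) <= #|V|%:R * E algII_gain.
Proof.
rewrite -PEZ; apply: PE_le => // w w0.
apply: le_trans (I_le_sum I0 Imono Isub _) _.
rewrite mulr_natl -[leRHS]sumr_const big_mkcond; apply: ler_sum => v _.
case: ifP => [/small_seedsP[c [_ cw]]|_]; last exact: Ige0.
exact: algII_gain_ge (accepts_upward w0 cw (cmaxP c)).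
Qed.

Definition offer_prob (s : act V C) : R := E (fun w => (small_offer s.1 w == s.2)%:R).

Lemma offer_prob_ge0 s : 0 <= offer_prob s.
Proof. by apply: PE_ge0. Qed.

Lemma offer_prob_le1 s : offer_prob s <= 1.
Proof. by rewrite -[leRHS](PE_const 1 sm); apply: PE_le => // w _; rewrite lern1 leq_b1. Qed.

Lemma offer_prob0 s : s \notin Sact V cv K B -> offer_prob s = 0.
Proof.
move=> sS; rewrite -[RHS](PE_const 0 sm); apply: eq_PE => w.
case: eqP => // H; move: sS; rewrite inE -H.
by rewrite small_offer_Psi.
Qed.

(** [small_offer v w] does not depend on [w v], so offering a set drawn from its law to a fresh copy
    of [v] has the same effect as the policy itself. *)
Lemma sum_offer_prob v (f : {set C} -> {set C} -> R) :
  \sum_psi offer_prob (v, psi) * E (fun w => f psi (w v)) =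
  E (fun w => f (small_offer v w) (w v)).
Proof.
transitivity (\sum_psi E (fun w => f psi (w v) * (small_offer v w == psi)%:R)).
  apply: eq_bigr => psi _; rewrite mulrC -PE_indepM //.
  by move=> w S; rewrite small_offer_upd.
rewrite -PE_sum; apply: eq_PE => w.
rewrite (bigD1 (small_offer v w)) //= eqxx mulr1 big1 ?addr0 // => psi.
by rewrite eq_sym => /negPf ->; rewrite mulr0.
Qed.

Lemma offer_prob_total v : \sum_psi offer_prob (v, psi) = 1.
Proof.
have := sum_offer_prob v (fun _ _ => 1); rewrite PE_const // => <-.
by apply: eq_bigr => psi _; rewrite mulr1.
Qed.

Lemma offer_prob_acc v :
  \sum_psi offer_prob (v, psi) * acc_prob cv p (v, psi) =
  E (fun w => (v \in small_seeds w)%:R).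
Proof.
rewrite (sum_offer_prob v (fun psi S => (first_acc cv psi S != None)%:R)).
by apply: eq_PE => w; rewrite inE.
Qed.

Lemma offer_prob_cost : \sum_s offer_prob s * bcost cv p s <= B.
Proof.
rewrite (_ : \sum_s _ = \sum_v \sum_psi offer_prob (v, psi) * E (fun w => paid cv psi (w v)));
  last by rewrite pair_bigA; apply: eq_bigr => -[].
under eq_bigr => v _ do rewrite (sum_offer_prob v (paid cv)).
rewrite -PE_sum -[leRHS](PE_const B sm); apply: PE_le => // w w0.
exact: small_paid_le.
Qed.

End PolicyBound.

(** * The discretized continuous greedy *)

Section ContinuousGreedy.
Variables (R : realType) (V C : finType).
Variables (cv : C -> R) (p : V -> C -> R) (I : {set V} -> R) (K : nat) (B beta : R).
Variable ys : nat -> act V C -> R.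
Hypothesis Ige0 : forall A : {set V}, 0 <= I A.
Hypothesis Imono : forall A A' : {set V}, A \subset A' -> I A <= I A'.
Hypothesis beta0 : 0 <= beta.
Hypothesis beta12 : beta <= 1 / 2.
Hypothesis B0 : 0 <= B.
Hypothesis ysP : cg_run cv p I K B beta ys.

Notation N := (Nsteps V cv K B).
Notation dt := (delta V cv K B).
Notation E := (PE (accept_weight p)).
Notation F y := (Fext cv p I y).

Lemma delta_ge0 : 0 <= dt.
Proof. by rewrite /delta divr_ge0. Qed.

Lemma mul_delta_le1 k : (k <= N)%N -> k%:R * dt <= 1.
Proof.
move=> kN; rewrite /delta mul1r; have [N0|N0] := posnP N.
  by move: kN; rewrite N0 leqn0 => /eqP ->; rewrite mul0r.
by rewrite ler_pdivrMr ?ltr0n // mul1r ler_nat.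
Qed.

Lemma greedy_run_inv k : (k <= N)%N ->
  [/\ forall s, 0 <= ys k s <= k%:R * dt,
      forall s, s \notin Sact V cv K B -> ys k s = 0 &
      \sum_s ys k s * bcost cv p s <= k%:R * dt * (beta * B)].
Proof.
have [y0 step] := ysP; elim: k => [_|k IH kN].
  split=> [s|s _|]; rewrite ?y0 ?mul0r ?lexx //.
  by rewrite big1 // => s _; rewrite y0 mul0r.
have [z [[[zS [z01 [_ zB]]] _] ysE]] := step k kN.
have [i1 i2 i3] := IH (ltnW kN).
have d0 := delta_ge0.
split=> [s|s sS|].
- by rewrite ysE -natr1; have := i1 s; have := z01 s; nra.
- by rewrite ysE i2 // zS // mulr0 addr0.
under eq_bigr => s _ do rewrite ysE mulrDl -mulrA.
rewrite big_split /= -mulr_sumr -natr1 mulrDl mul1r mulrDl.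
apply: lerD => //; apply: ler_wpM2l => //; apply: le_trans zB.
rewrite le_eqVlt; apply/orP; left; apply/eqP; rewrite [RHS]big_mkcond.
by apply: eq_bigr => s _; case: ifPn => // sS; rewrite zS // mul0r.
Qed.

Lemma greedy_unit_valued k : (k <= N)%N -> unit_valued (ys k).
Proof.
move=> kN s; have [i1 _ _] := greedy_run_inv kN.
by have := i1 s; have := mul_delta_le1 kN; lra.
Qed.

Lemma greedy_budget : \sum_s ys N s * bcost cv p s <= beta * B.
Proof.
have [_ _ i3] := greedy_run_inv (leqnn N); apply: le_trans i3 _.
rewrite -[leRHS]mul1r; apply: ler_wpM2r; first exact: mulr_ge0.
exact: mul_delta_le1.
Qed.

Lemma Fext_ge0 y : unit_valued y -> 0 <= F y.
Proof.
by move=> y01; apply: EB_ge0 => // A; rewrite fSE; apply: PE_ge0 => //;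
  exact: accept_weight_stochastic.
Qed.

Section Comparison.
Variables (x : act V C -> R) (O : R).
Hypothesis xS : forall s, s \notin Sact V cv K B -> x s = 0.
Hypothesis x01 : unit_valued x.
Hypothesis x1 : forall v, \sum_psi x (v, psi) <= 1.
Hypothesis xB : \sum_s x s * bcost cv p s <= B.
Hypothesis O0 : 0 <= O.
Hypothesis xO : forall y, unit_valued y ->
  O - 2 * F y <= \sum_s x s * (EB y (fun A => fS cv p I (s |: A)) - F y).

Lemma sum_Sact (f g : act V C -> R) : (forall s, s \notin Sact V cv K B -> g s = 0) ->
  \sum_(s in Sact V cv K B) f s * g s = \sum_s g s * f s.
Proof.
move=> g0; rewrite big_mkcond; apply: eq_bigr => s _.
by case: ifPn => [|sS]; [rewrite mulrC | rewrite g0 // mul0r].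
Qed.

Lemma sum_act (f : act V C -> R) : \sum_s f s = \sum_v \sum_psi f (v, psi).
Proof. by rewrite pair_bigA; apply: eq_bigr => -[]. Qed.

(** Optimality against the competitor [beta * x] bounds the linearized gain, and [EB_step] with
    [d = dt * z] turns it into a true gain up to the factor [1 - dt * #|V|%:R]. *)
Lemma greedy_step k : (k < N)%N -> 0 <= 1 - dt * #|V|%:R ->
  F (ys k) + dt * (1 - dt * #|V|%:R) * (beta * (O - 2 * F (ys k))) <= F (ys k.+1).
Proof.
move=> kN eps0; have [_ step] := ysP.
have [z [[[zS [z01 [zV zB]]] zopt] ysE]] := step k kN.
have y01 := greedy_unit_valued (ltnW kN).
have y01' := greedy_unit_valued kN.
have [_ yS _] := greedy_run_inv (ltnW kN).
have d0 := delta_ge0.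
pose m s := EB (ys k) (fun A => fS cv p I (s |: A)) - F (ys k).
have m0 s : 0 <= m s.
  by rewrite subr_ge0; apply: EB_le => // A; apply: fS_incr => //; exact: finset.subsetUr.
have margE s : marg cv p I K B (ys k) s = m s by rewrite /marg !(ER_EB _ yS).
have xfeas : LPfeas cv p K B beta (fun s => beta * x s).
  split=> [s sS|]; first by rewrite xS // mulr0.
  split=> [s|]; first by have := x01 s; have := beta0; have := beta12; nra.
  split=> [v|].
    rewrite -mulr_sumr; have := x1 v.
    have : \sum_(psi in Psi cv K B) x (v, psi) <= \sum_psi x (v, psi).
      rewrite [leLHS]big_mkcond; apply: ler_sum => psi _; case: ifP => // _.
      by have /andP[] := x01 (v, psi).
    have : 0 <= \sum_(psi in Psi cv K B) x (v, psi).
      by apply: sumr_ge0 => psi _; have /andP[] := x01 (v, psi).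
    by have := beta0; have := beta12; nra.
  under eq_bigr => s _ do rewrite -mulrA.
  rewrite -mulr_sumr; apply: ler_wpM2l => //.
  under eq_bigr => s _ do rewrite mulrC.
  by rewrite sum_Sact.
have zx : beta * (O - 2 * F (ys k)) <= \sum_s z s * m s.
  have := zopt _ xfeas.
  under eq_bigr => s _ do rewrite margE.
  under [leRHS]eq_bigr => s _ do rewrite margE.
  rewrite (sum_Sact _ zS) (@sum_Sact _ (fun s => beta * x s)); last first.
    by move=> s sS; rewrite xS // mulr0.
  under eq_bigr => s _ do rewrite -mulrA.
  by rewrite -mulr_sumr; apply: le_trans; apply: ler_wpM2l => //; exact: xO.
(* The linear program allots at most one unit to each user. *)
have Sz : \sum_s dt * z s <= dt * #|V|%:R.
  rewrite -mulr_sumr; apply: ler_wpM2l => //.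
  rewrite sum_act -[leRHS]mulr1 mulr_natl -sumr_const; apply: ler_sum => v _.
  apply: le_trans (zV v); rewrite [leRHS]big_mkcond; apply: ler_sum => psi _.
  by case: ifPn => // psiP; rewrite zS // inE.
have dz01 : unit_valued (fun s => dt * z s).
  move=> s; have := y01' s; have := y01 s; rewrite ysE; have := z01 s; nra.
have yd01 : unit_valued (fun s => ys k s + dt * z s).
  by move=> s; rewrite -ysE; exact: y01'.
have := EB_step y01 dz01 yd01 (fS_incr cv p Imono).
rewrite (_ : EB (fun s => ys k s + dt * z s) _ = F (ys k.+1)); last first.
  by congr EB; apply/funext => s; rewrite ysE.
rewrite -/(F (ys k)); apply: le_trans; rewrite lerD2l.
rewrite [X in _ <= _ * X](_ : _ = dt * \sum_s z s * m s); last first.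
  by rewrite mulr_sumr; apply: eq_bigr => s _; rewrite mulrA.
have mz0 : 0 <= \sum_s z s * m s.
  by apply: sumr_ge0 => s _; apply: mulr_ge0 => //; have /andP[] := z01 s.
apply: (@le_trans _ _ (dt * (1 - dt * #|V|%:R) * \sum_s z s * m s)).
  by apply: ler_wpM2l => //; exact: mulr_ge0.
rewrite -mulrA mulrCA; apply: ler_wpM2r; first exact: mulr_ge0.
by rewrite lerD2l lerN2.
Qed.

(** With [a = dt * (1 - dt * #|V|%:R) * beta], the recursion [f' >= (1 - 2 a) f + a O] is solved by
    [(1 - (1 - 2 a)^k) / 2 * O]; the quadratic in [q = k a] is a lower bound that is stable under
    the step. *)
Lemma greedy_progress k : (k <= N)%N -> 0 <= 1 - dt * #|V|%:R ->
  let q := k%:R * (dt * (1 - dt * #|V|%:R) * beta) in (q - q ^+ 2) * O <= F (ys k).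
Proof.
move=> + eps0; elim: k => [|k IH] kN /=.
  by rewrite mul0r expr0n subrr mul0r; exact/Fext_ge0/greedy_unit_valued.
have := IH (ltnW kN); have := greedy_step kN eps0; rewrite /= -[k.+1%:R]natr1.
have dt1 : dt <= 1 by have := mul_delta_le1 (leq_trans (ltn0Sn k) kN); rewrite mul1r.
have d0 := delta_ge0.
set f := F (ys k); set f' := F (ys k.+1); set e := 1 - _ in eps0 *.
have e1 : e <= 1 by rewrite /e lerBlDr lerDl mulr_ge0.
set a := dt * e * beta.
have a0 : 0 <= a by rewrite /a !mulr_ge0.
have a12 : 2 * a <= 1.
  have : dt * e <= 1 by nra.
  have : 0 <= dt * e by exact: mulr_ge0.
  by rewrite /a; have := beta0; have := beta12; nra.
have -> : dt * e * (beta * (O - 2 * f)) = a * (O - 2 * f) by rewrite /a; ring.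
have k0 : 0 <= k%:R :> R by [].
move: (k%:R) k0 => r r0 st ih.
have h1 : (1 - 2 * a) * ((r * a - (r * a) ^+ 2) * O) <= (1 - 2 * a) * f.
  by apply: ler_wpM2l => //; lra.
(* The exact slack of the induction step. *)
have h2 : 0 <= a ^+ 2 * (1 + 2 * a * r ^+ 2) * O.
  by rewrite !mulr_ge0 ?sqr_ge0 // addr_ge0 // !mulr_ge0 ?sqr_ge0.
apply: le_trans st.
apply: (@le_trans _ _ ((1 - 2 * a) * f + a * O)); last by lra.
apply: (@le_trans _ _ ((1 - 2 * a) * ((r * a - (r * a) ^+ 2) * O) + a * O)); last by lra.
rewrite -subr_ge0; apply: le_trans h2 _.
rewrite le_eqVlt; apply/orP; left; apply/eqP; ring.
Qed.

End Comparison.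
End ContinuousGreedy.

(** * Combining the two algorithms *)

Lemma Nsteps_gt0 (R : realType) (V C : finType) (cv : C -> R) K B :
  (0 < #|V|)%N -> (0 < Nsteps V cv K B)%N.
Proof.
move=> V0; rewrite expn_gt0 muln_gt0 V0 /=; apply/orP; left.
apply/card_gt0P; exists finset.set0; rewrite inE finset.sub0set finset.cards0.
by [].
Qed.

(** The square in the definition of [Nsteps] gives at least [#|V| ^ 2] steps, as [Psi] contains the
    empty set. *)
Lemma delta_card_sqr_le1 (R : realType) (V C : finType) (cv : C -> R) K B :
  delta V cv K B * #|V|%:R * #|V|%:R <= 1 :> R.
Proof.
have [V0|V0] := posnP #|V|; first by rewrite V0 mulr0.
have N0 := Nsteps_gt0 cv K B V0.
rewrite /delta mul1r -mulrA -natrM ler_pdivrMl ?ltr0n // mulr1 ler_nat.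
rewrite /Nsteps in N0 *; move: N0; rewrite expn_gt0 muln_gt0 V0 /= orbF => P0.
by rewrite mulnn leq_exp2r // leq_pmulr.
Qed.

(* The discretization of the greedy loses up to a multiple of b * e * O, which for
   small b is not covered by the slack of the bound b - b^2; ALG II pays for it,
   since n * e <= 1 and O <= n * J. *)
Lemma combine_bounds (R : realFieldType) (c b e n O J F a : R) :
  0 <= c <= 1 -> 0 <= b <= 1 / 2 -> 0 <= e -> 0 <= 1 - e -> n * e <= 1 ->
  0 <= O -> 0 <= J -> O <= n * J ->
  (b * (1 - e) - (b * (1 - e)) ^+ 2) * O <= F -> c * (1 - 2 * b) * F <= a ->
  c * (1 - b) * (1 - 2 * b) * b * (O + J) <= a + J.
Proof.
move=> c01 b01 e0 e1 ne O0 J0 OJ HF Ha.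
have k0 : 0 <= c * (1 - 2 * b) by apply: mulr_ge0; lra.
have k1 : c * (1 - 2 * b) <= 1 by nra.
have eO : e * O <= J.
  apply: (@le_trans _ _ (e * (n * J))); first exact: ler_wpM2l.
  by rewrite mulrA -[leRHS]mul1r; apply: ler_wpM2r => //; rewrite mulrC.
have HF' : (b - b ^+ 2) * O - b * (e * O) <= F.
  apply: le_trans HF; rewrite -subr_ge0.
  have -> : (b * (1 - e) - (b * (1 - e)) ^+ 2) * O -
    ((b - b ^+ 2) * O - b * (e * O)) = b ^+ 2 * (e * (1 + (1 - e))) * O by ring.
  by rewrite !mulr_ge0 ?sqr_ge0 //; lra.
have H1 := le_trans (ler_wpM2l k0 HF') Ha.
set k := c * (1 - 2 * b) in k0 k1 H1 *.
have -> : c * (1 - b) * (1 - 2 * b) * b = k * (b - b ^+ 2) by rewrite /k; ring.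
have b2 : 0 <= b - b ^+ 2 <= 1 / 2 by nra.
(* The [J] on the right is split in halves: one pays for the discretization loss, the other for the
   term in [J] on the left. *)
have H2 : k * (b * (e * O)) <= J / 2.
  apply: (@le_trans _ _ (1 * (b * (e * O)))).
    by apply: ler_wpM2r => //; rewrite !mulr_ge0 //; lra.
  have : 0 <= e * O by exact: mulr_ge0.
  by nra.
have H3 : k * (b - b ^+ 2) * J <= J / 2.
  rewrite mulrC; apply: ler_wpM2l => //; nra.
by lra.
Qed.

(** A randomized policy is a convex combination of deterministic ones. The idle policy shows that
    the supremum is over a nonempty set. *)
Lemma sup_rvalue_le (R : realType) (V C : finType) (cv : C -> R) (p : V -> C -> R)
    (I : {set V} -> R) (K : nat) (B g S : R) :
  0 <= B -> 0 <= g ->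
  (forall pi, det_feasible cv p K B pi -> g * det_value p I K pi <= S) ->
  g * OPT cv p I K B <= S.
Proof.
move=> B0 g0 H.
pose idle : policy V C := fun=> None.
have idleP : det_feasible cv p K B idle.
  by move=> w _; split=> //; rewrite /redeemed /trace /= big_nil.
have HR rp : rfeasible cv p K B rp -> g * rvalue p I K rp <= S.
  move=> [r0 [r1 rP]]; rewrite -[leRHS]mul1r -r1 mulr_suml /rvalue mulr_sumr.
  elim: rp r0 rP {r1} => [|[x pi] rp IH] r0 rP; first by rewrite !big_nil.
  rewrite !big_cons; apply: lerD; last first.
    by apply: IH => y yr; [apply: r0; right | apply: rP; right].
  have x0 : 0 <= x := r0 _ (or_introl erefl).
  rewrite mulrCA /=; move: (x0); rewrite le_eqVlt => /orP[/eqP <-|xp].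
    by rewrite !mul0r.
  by apply: ler_wpM2l => //; apply: H; exact: (rP _ (or_introl erefl)).
have [g_eq0|g_neq0] := eqVneq g 0.
  have := H idle idleP; rewrite g_eq0 !mul0r //.
have gp : 0 < g by rewrite lt_neqAle eq_sym g_neq0.
rewrite mulrC -ler_pdivlMr //; apply: ge_sup => [|_ [rp [/HR Hrp ->]]]; last first.
  by rewrite ler_pdivlMr // mulrC.
exists (rvalue p I K [:: (1, idle)]), [:: (1, idle)]; split=> //.
split; first by move=> x [<-|[]] /=.
by split; [rewrite big_seq1 | move=> x [<-|[]]].
Qed.

Theorem theorem1 (R : realType) (V C : finType) (cv : C -> R) (p : V -> C -> R)
  (I : {set V} -> R) (K : nat) (B beta : R)
  (cmax : C) (ys : nat -> (V * {set C}) -> R)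
  (crs : {set (V * {set C})} -> {set (V * {set C})} -> R)
  (ord : {set (V * {set C})} -> seq (V * {set C})) (lst : seq V) :
  0 <= beta <= 1 / 2 ->
  0 <= B ->
  (forall c, 0 <= cv c) -> injective cv ->
  (forall v c, 0 <= p v c <= 1) ->
  (forall v c c', cv c <= cv c' -> p v c <= p v c') ->
  (forall A : {set V}, 0 <= I A) -> I finset.set0 = 0 ->
  (forall A A' : {set V}, A \subset A' -> I A <= I A') ->
  (forall A A' : {set V}, I (A :|: A') + I (A :&: A') <= I A + I A') ->
  (* ALG I: continuous greedy run (any choice of optimal LP solutions) *)
  cg_run cv p I K B beta ys ->
  (* a monotone (1 - 1/e)-balanced CRS at y^g *)
  is_crs (ys (Nsteps V cv K B)) crs ->
  crs_balanced cv K B (1 - (expR 1)^-1) (ys (Nsteps V cv K B)) crs ->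
  crs_monotone crs ->
  (* arbitrary order in step (3) *)
  (forall Z : {set (V * {set C})}, perm_eq (ord Z) (enum Z)) ->
  (* ALG II: c_max and users sorted by nonincreasing I({v}) *)
  (forall c, cv c <= cv cmax) ->
  perm_eq lst (enum V) -> sorted (fun a b => I [set b] <= I [set a]) lst ->
  ((1 - (expR 1)^-1) * (1 - beta) * (1 - 2 * beta) * beta / 2) * OPT cv p I K B
    <= stochCP_value cv p I K B ys crs ord cmax lst.
Proof.
move=> /andP[beta0 beta12] B0 cv0 _ _ pmono Ige0 I0 Imono Isub ysP crsP crs_bal
  crs_mon ordP cmaxP lstP lst_sorted.
set c := 1 - _ in crs_bal *.
have e1 : 1 <= expR 1 :> R by rewrite -[leLHS]expR0 ler_expR.
have c01 : 0 <= c <= 1.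
  have : (expR 1)^-1 <= 1 :> R by rewrite invf_le1 // expR_gt0.
  by have : 0 <= (expR 1)^-1 :> R; [rewrite invr_ge0 expR_ge0 | rewrite /c; lra].
have sm := accept_weight_stochastic p.
have yN01 : unit_valued (ys (Nsteps V cv K B)).
  exact: (greedy_unit_valued ysP).
have [_ yNS _] := greedy_run_inv ysP (leqnn _).
have algI_geF : c * (1 - 2 * beta) * Fext cv p I (ys (Nsteps V cv K B)) <=
    algI_value cv p I K B (ys (Nsteps V cv K B)) crs ord.
  apply: algI_ge => //; first exact: (greedy_budget beta0 B0 ysP).
  by case/andP: c01.
apply: sup_rvalue_le => // [|pi piP].
  rewrite divr_ge0 // !mulr_ge0 //; move: c01 beta12; lra.
set O := PE (accept_weight p) (fun w => I (small_seeds cv K B pi w)).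
set J := algII_value p I cmax lst.
have value_le : det_value p I K pi <= O + J.
  exact: det_value_le.
have OJ : O <= #|V|%:R * J.
  exact: small_value_le.
have O0 : 0 <= O by apply: PE_ge0.
have J0 : 0 <= J by apply: PE_ge0.
have x01 : unit_valued (offer_prob cv p K B pi).
  by move=> s; rewrite offer_prob_ge0 offer_prob_le1.
have x1 v : \sum_psi offer_prob cv p K B pi (v, psi) <= 1 by rewrite offer_prob_total.
have dominate y : unit_valued y -> O - 2 * Fext cv p I y <= \sum_s
    offer_prob cv p K B pi s * (EB y (fun A => fS cv p I (s |: A)) - Fext cv p I y).
  move=> y01; apply: marginals_dominate => //.
  - by move=> s; exact: offer_prob_ge0.
  - by move=> v; exact: offer_prob_acc.
pose eps := delta V cv K B * #|V|%:R : R.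
have eps0 : 0 <= eps by apply: mulr_ge0 => //; exact: delta_ge0.
have neps : #|V|%:R * eps <= 1 by rewrite mulrC; exact: delta_card_sqr_le1.
have Fge0 : 0 <= Fext cv p I (ys (Nsteps V cv K B)) by exact: Fext_ge0.
suff : c * (1 - beta) * (1 - 2 * beta) * beta * (O + J) <=
    algI_value cv p I K B (ys (Nsteps V cv K B)) crs ord + J.
  have g0 : 0 <= c * (1 - beta) * (1 - 2 * beta) * beta.
    by rewrite !mulr_ge0 //; move: c01 beta12; lra.
  have := ler_wpM2l g0 value_le; rewrite /stochCP_value -/J; lra.
(* Without users the greedy makes no step and [delta] is [1 / 0 = 0]; but then [O = 0], and the
   bounds combine with [e = n = 0]. *)
have [V0|V0] := posnP #|V|.
  have OE : O = 0 by apply: le_anti; rewrite O0 andbT; move: OJ; rewrite V0 mul0r.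
  apply: (combine_bounds (e := 0) (n := 0) c01 _ _ _ _ _ J0 _ _ algI_geF);
    rewrite ?OE ?mulr0 ?mul0r ?subr0 //; exact/andP.
have eps1 : 0 <= 1 - eps.
  have : 1 <= #|V|%:R :> R by rewrite ler1n.
  by rewrite subr_ge0; nra.
apply: (combine_bounds c01 _ eps0 eps1 neps O0 J0 OJ _ algI_geF); first exact/andP.
have := greedy_progress Ige0 Imono beta0 beta12 ysP
  (offer_prob0 p pi) x01 x1 (offer_prob_cost cv0 B0 piP) O0 dominate (leqnn _) eps1.
rewrite /= -/eps.
(* The step size is the inverse of the number of steps, so the final [q] is [beta * (1 - eps)]. *)
have -> : (Nsteps V cv K B)%:R * (delta V cv K B * (1 - eps) * beta) = beta * (1 - eps).
  have N0 : (Nsteps V cv K B)%:R != 0 :> R by rewrite pnatr_eq0 -lt0n Nsteps_gt0.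
  by rewrite /delta; field.
by [].
Qed.
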